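(* Let $G$ be a tubular group. Then $G$ is residually finite if and only if $G$ is virtually primitive.
   Context: A finitely generated group $G$ is tubular if it splits as a finite graph of groups (i.e. is the fundamental group of a finite connected graph of groups) in which every vertex group is isomorphic to $\mathbb{Z}^2$ and every edge group is isomorphic to $\mathbb{Z}$, with injective attaching maps; a tubular group is considered together with such a splitting. A tubular group $G$ is primitive if the image of each edge group under each of its two attaching maps is a maximal cyclic subgroup of the corresponding vertex group. A finite index subgroup $G'\leqslant G$ of a tubular group inherits, from its action on the Bass–Serre tree of $G$, an induced splitting making it a tubular group. $G$ is virtually primitive if it has a finite index subgroup $G'$ which, with the induced splitting, is a primitive tubular group. A group $G$ is residually finite if for each nontrivial $g\in G$ there is a finite quotient of $G$ in which the image of $g$ is nontrivial. *)

(* Defs.v *)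
From HB Require Import structures.
From mathcomp Require Import fingroup all_boot ssralg ssrint.
From mathcomp Require Import boolp classical_sets functions cardinality.

Set Implicit Arguments.
Unset Strict Implicit.
Unset Printing Implicit Defensive.

Local Open Scope group_scope.
Local Open Scope classical_set_scope.
Local Open Scope quotient_scope.

Definition is_subgroup (G : groupType) (H : set G) : Prop :=
  H 1 /\ forall x y, H x -> H y -> H (x / y).

(* When H is a subgroup, [translate g H] is the left coset gH. *)
Definition translate (G : groupType) (g : G) (A : set G) : set G :=
  [set x | A (g^-1 * x)].

Definition finite_index (G : groupType) (H : set G) : Prop :=
  finite_set (range (fun g => translate g H)).

Definition residually_finite (G : groupType) : Prop :=
  forall g : G, g <> 1 ->
    exists (Q : finGroupType) (f : {multiplicative G -> Q}),
      (forall q, exists x, f x = q) /\ f g <> 1.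

Definition powers (A : groupType) (a : A) : set A :=
  [set x | exists n, x = a ^+ n \/ x = a ^- n].

Definition is_cyclic (A : groupType) (C : set A) : Prop :=
  exists a, C = powers a.

Definition is_maximal_cyclic (A : groupType) (C : set A) : Prop :=
  is_cyclic C /\ forall D, is_cyclic D -> C `<=` D -> D = C.

Definition isomorphic_to_Z (A : groupType) : Prop :=
  exists f : int -> A, bijective f /\ {morph f : x y / (x + y)%R >-> x * y}.

Definition isomorphic_to_Z2 (A : groupType) : Prop :=
  exists f : int * int -> A,
    bijective f /\ {morph f : x y / (x + y)%R >-> x * y}.

(* Graphs of groups.  Each geometric edge is listed once, with a chosen       *)
(* orientation from [esrc] to [etgt]; loops and multiple edges are allowed.   *)

Definition edge_adj (V E : finType) (s t : E -> V) (A : {set E}) : rel V :=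
  fun u v => [exists e in A, ((s e, t e) == (u, v)) || ((s e, t e) == (v, u))].

Definition connected_via (V E : finType) (s t : E -> V) (A : {set E}) : Prop :=
  forall u v, connect (edge_adj s t A) u v.

Record graph_of_groups := GraphOfGroups {
  vertex : finType;
  edge : finType;
  esrc : edge -> vertex;
  etgt : edge -> vertex;
  vertex_inhabited : (0 < #|vertex|)%N;
  graph_connected : connected_via esrc etgt finset.setT;
  vgroup : vertex -> groupType;
  egroup : edge -> groupType;
  att_src : forall e, {multiplicative egroup e -> vgroup (esrc e)};
  att_tgt : forall e, {multiplicative egroup e -> vgroup (etgt e)};
  att_src_inj : forall e, injective (att_src e);
  att_tgt_inj : forall e, injective (att_tgt e)
}.

Definition is_tubular (Y : graph_of_groups) : Prop :=
  (forall v : vertex Y, isomorphic_to_Z2 (vgroup v)) /\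
  (forall e : edge Y, isomorphic_to_Z (egroup e)).

Definition is_primitive (Y : graph_of_groups) : Prop :=
  forall e : edge Y,
    is_maximal_cyclic (range (att_src e)) /\
    is_maximal_cyclic (range (att_tgt e)).

(* A set of edges forms a spanning tree when it connects all the vertices and *)
(* none of its edges can be dropped (a loop or an edge on a cycle could be).  *)
Definition is_spanning_tree (Y : graph_of_groups) (T : {set edge Y}) : Prop :=
  connected_via (@esrc Y) (@etgt Y) T /\
  forall e, e \in T -> ~ connected_via (@esrc Y) (@etgt Y) (T :\ e).

(* The fundamental group of Y relative to T: words in the elements of the     *)
(* vertex groups (left summand) and the signed stable letters t_e, where      *)
(* [inr (e, true)] is t_e and [inr (e, false)] its inverse, modulo the        *)
(* relations of the vertex groups, t_e att_tgt(c) t_e^-1 = att_src(c) for c   *)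
(* in the group of e, and t_e = 1 for e in T.                                 *)

Definition letter (Y : graph_of_groups) : choiceType :=
  ({v : vertex Y & vgroup v} + (edge Y * bool))%type.

Definition word (Y : graph_of_groups) : choiceType := seq (letter Y).

Definition vletter (Y : graph_of_groups) (v : vertex Y) (a : vgroup v) :
  letter Y := inl (existT _ v a).

Definition eletter (Y : graph_of_groups) (e : edge Y) (b : bool) : letter Y :=
  inr (e, b).

Definition inv_letter (Y : graph_of_groups) (l : letter Y) : letter Y :=
  match l with
  | inl (existT v a) => vletter a^-1
  | inr (e, b) => eletter e (~~ b)
  end.

Definition inv_word (Y : graph_of_groups) (w : word Y) : word Y :=
  rev (map (@inv_letter Y) w).

Inductive word_rel (Y : graph_of_groups) (T : {set edge Y}) :
    word Y -> word Y -> Prop :=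
  | word_rel_refl w : word_rel T w w
  | word_rel_sym w1 w2 : word_rel T w1 w2 -> word_rel T w2 w1
  | word_rel_trans w1 w2 w3 :
      word_rel T w1 w2 -> word_rel T w2 w3 -> word_rel T w1 w3
  | word_rel_cat w1 w1' w2 w2' :
      word_rel T w1 w1' -> word_rel T w2 w2' ->
      word_rel T (w1 ++ w2) (w1' ++ w2')
  | word_rel_one (v : vertex Y) : word_rel T [:: vletter (1 : vgroup v)] [::]
  | word_rel_mul (v : vertex Y) (a b : vgroup v) :
      word_rel T [:: vletter a; vletter b] [:: vletter (a * b)]
  | word_rel_stable (e : edge Y) (b : bool) :
      word_rel T [:: eletter e b; eletter e (~~ b)] [::]
  | word_rel_edge (e : edge Y) (c : egroup e) :
      word_rel T [:: eletter e true; vletter (att_tgt e c); eletter e false]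
                 [:: vletter (att_src e c)]
  | word_rel_tree (e : edge Y) :
      e \in T -> word_rel T [:: eletter e true] [::].

Section Pi1.
Variables (Y : graph_of_groups) (T : {set edge Y}).

Definition word_relb : rel (word Y) := fun w1 w2 => `[< word_rel T w1 w2 >].

Lemma word_relb_refl : reflexive word_relb.
Proof. by move=> w; apply/asboolP; exact: word_rel_refl. Qed.

Lemma word_relb_sym : symmetric word_relb.
Proof.
by move=> w1 w2; apply/asboolP/asboolP; exact: word_rel_sym.
Qed.

Lemma word_relb_trans : transitive word_relb.
Proof.
move=> w2 w1 w3 /asboolP h12 /asboolP h23; apply/asboolP.
exact: word_rel_trans h12 h23.
Qed.

Canonical word_equiv :=
  EquivRel word_relb word_relb_refl word_relb_sym word_relb_trans.

Definition pi1 := {eq_quot word_equiv}.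

HB.instance Definition _ := Choice.on pi1.
HB.instance Definition _ := EqQuotient.on pi1.

Definition pi1_class (w : word Y) : pi1 := \pi_pi1 w.

Lemma pi1_classP w1 w2 : pi1_class w1 = pi1_class w2 <-> word_rel T w1 w2.
Proof.
split=> [/eqquotP /asboolP //| h]; exact/eqquotP/asboolP.
Qed.

Lemma pi1_class_repr (x : pi1) : pi1_class (repr x) = x.
Proof. exact: reprK. Qed.

Lemma word_rel_repr w : word_rel T (repr (pi1_class w)) w.
Proof. by apply/pi1_classP; rewrite pi1_class_repr. Qed.

Lemma word_rel_inv_letter (l : letter Y) : word_rel T [:: l; inv_letter l] [::].
Proof.
case: l => [[v a]|[e b]] /=; last exact: word_rel_stable.
apply: word_rel_trans (word_rel_mul T a a^-1) _.
rewrite mulgV; exact: word_rel_one.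
Qed.

Lemma inv_letterK : involutive (@inv_letter Y).
Proof. by case=> [[v a]|[e b]] /=; rewrite /vletter /eletter ?invgK ?negbK. Qed.

Lemma inv_wordK : involutive (@inv_word Y).
Proof.
move=> w; rewrite /inv_word map_rev revK -map_comp -[RHS]map_id.
by apply: eq_map => l /=; rewrite inv_letterK.
Qed.

Lemma word_rel_mulV w : word_rel T (w ++ inv_word w) [::].
Proof.
elim: w => [|l w IHw]; first exact: word_rel_refl.
rewrite /inv_word /= rev_cons -cats1.
apply: word_rel_trans (word_rel_inv_letter l).
rewrite -/(inv_word w) catA.
apply: (@word_rel_cat _ _ [:: l] [:: l] _ [:: inv_letter l]).
  exact: word_rel_refl.
rewrite -[X in word_rel _ _ X]cat0s.
by apply: word_rel_cat; [exact: IHw | exact: word_rel_refl].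
Qed.

Lemma word_rel_Vmul w : word_rel T (inv_word w ++ w) [::].
Proof. by rewrite -{2}[w]inv_wordK; exact: word_rel_mulV. Qed.

Lemma word_rel_inv w1 w2 :
  word_rel T w1 w2 -> word_rel T (inv_word w1) (inv_word w2).
Proof.
move=> h12.
apply: (@word_rel_trans _ _ _ (inv_word w1 ++ (w2 ++ inv_word w2))).
  rewrite -[X in word_rel _ X _]cats0; apply: word_rel_cat.
    exact: word_rel_refl.
  exact/word_rel_sym/word_rel_mulV.
rewrite catA -[X in word_rel _ _ X]cat0s; apply: word_rel_cat.
  apply: word_rel_trans (word_rel_Vmul w1).
  by apply: word_rel_cat; [exact: word_rel_refl | exact: word_rel_sym].
exact: word_rel_refl.
Qed.

Definition pi1_one : pi1 := pi1_class [::].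
Definition pi1_mul (x y : pi1) : pi1 := pi1_class (repr x ++ repr y).
Definition pi1_inv (x : pi1) : pi1 := pi1_class (inv_word (repr x)).

Lemma pi1_mulE w1 w2 :
  pi1_mul (pi1_class w1) (pi1_class w2) = pi1_class (w1 ++ w2).
Proof. by apply/pi1_classP/word_rel_cat; exact: word_rel_repr. Qed.

Lemma pi1_invE w : pi1_inv (pi1_class w) = pi1_class (inv_word w).
Proof. by apply/pi1_classP/word_rel_inv; exact: word_rel_repr. Qed.

Lemma pi1_mulA : associative pi1_mul.
Proof.
move=> x y z.
by rewrite -[x]pi1_class_repr -[y]pi1_class_repr -[z]pi1_class_repr !pi1_mulE
  catA.
Qed.

Lemma pi1_mul1g : left_id pi1_one pi1_mul.
Proof. by move=> x; rewrite -[x]pi1_class_repr pi1_mulE. Qed.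

Lemma pi1_mulg1 : right_id pi1_one pi1_mul.
Proof. by move=> x; rewrite -[x]pi1_class_repr pi1_mulE cats0. Qed.

Lemma pi1_mulVg : left_inverse pi1_one pi1_inv pi1_mul.
Proof.
move=> x; rewrite -[x]pi1_class_repr pi1_invE pi1_mulE.
exact/pi1_classP/word_rel_Vmul.
Qed.

Lemma pi1_mulgV : right_inverse pi1_one pi1_inv pi1_mul.
Proof.
move=> x; rewrite -[x]pi1_class_repr pi1_invE pi1_mulE.
exact/pi1_classP/word_rel_mulV.
Qed.

HB.instance Definition _ :=
  isGroup.Build pi1 pi1_mulA pi1_mul1g pi1_mulg1 pi1_mulVg pi1_mulgV.

End Pi1.

(* A splitting of G: an identification of G with the fundamental group of a   *)
(* finite connected graph of groups.                                          *)
Record splitting (G : groupType) := Splitting {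
  gog : graph_of_groups;
  stree : {set edge gog};
  streeP : is_spanning_tree stree;
  spi1 : {multiplicative pi1 stree -> G};
  spi1_bij : bijective spi1
}.

Definition in_vgroup (G : groupType) (S : splitting G) (v : vertex (gog S))
  (a : vgroup v) : G := spi1 S (pi1_class (stree S) [:: vletter a]).
Arguments in_vgroup {G} S {v} a.

Definition stable_letter (G : groupType) (S : splitting G) (e : edge (gog S)) :
  G := spi1 S (pi1_class (stree S) [:: eletter e true]).
Arguments stable_letter {G} S e.

(* The image in G of the group of e is taken through its source. *)
Definition vimage (G : groupType) (S : splitting G) (v : vertex (gog S)) :
  set G := range (fun a : vgroup v => in_vgroup S a).
Arguments vimage {G} S v.

Definition eimage (G : groupType) (S : splitting G) (e : edge (gog S)) :
  set G := range (fun c : egroup e => in_vgroup S (att_src e c)).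
Arguments eimage {G} S e.

Record Ggraph (G : groupType) := GGraph {
  gvert : Type;
  gedge : Type;
  gsrc : gedge -> gvert;
  gtgt : gedge -> gvert;
  vact : G -> gvert -> gvert;
  eact : G -> gedge -> gedge;
  vact1 : forall x, vact 1 x = x;
  vactM : forall g h x, vact (g * h) x = vact g (vact h x);
  eact1 : forall y, eact 1 y = y;
  eactM : forall g h y, eact (g * h) y = eact g (eact h y);
  gsrc_act : forall g y, gsrc (eact g y) = vact g (gsrc y);
  gtgt_act : forall g y, gtgt (eact g y) = vact g (gtgt y)
}.

(* The Bass-Serre tree: its vertices are the cosets g G_v, its edges the      *)
(* cosets g G_e, where g G_e goes from g G_(esrc e) to g t_e G_(etgt e).      *)

Section BassSerre.
Variables (G : groupType) (S : splitting G).
Notation Y := (gog S).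

Definition bs_vertex := {x : vertex Y * set G |
  exists g, x.2 = translate g (vimage S x.1)}.

Definition bs_edge := {x : edge Y * set G |
  exists g, x.2 = translate g (eimage S x.1)}.

Lemma translate1 (A : set G) : translate 1 A = A.
Proof. by apply/funext => x; rewrite /translate /= invg1 mul1g. Qed.

Lemma translateM (g h : G) (A : set G) :
  translate (g * h) A = translate g (translate h A).
Proof. by apply/funext => x; rewrite /translate /= invgM mulgA. Qed.

Lemma bs_vact_proof g (x : bs_vertex) :
  exists h, translate g (sval x).2 = translate h (vimage S (sval x).1).
Proof.
by case: x => [[v C] /= [h ->]]; exists (g * h); rewrite translateM.
Qed.

Definition bs_vact (g : G) (x : bs_vertex) : bs_vertex :=
  exist _ ((sval x).1, translate g (sval x).2) (bs_vact_proof g x).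

Lemma bs_eact_proof g (x : bs_edge) :
  exists h, translate g (sval x).2 = translate h (eimage S (sval x).1).
Proof.
by case: x => [[v C] /= [h ->]]; exists (g * h); rewrite translateM.
Qed.

Definition bs_eact (g : G) (x : bs_edge) : bs_edge :=
  exist _ ((sval x).1, translate g (sval x).2) (bs_eact_proof g x).

Lemma bs_vertex_eq (x y : bs_vertex) : sval x = sval y -> x = y.
Proof. by case: x y => [x px] [y py]; exact: eq_exist. Qed.

Lemma bs_edge_eq (x y : bs_edge) : sval x = sval y -> x = y.
Proof. by case: x y => [x px] [y py]; exact: eq_exist. Qed.

Lemma in_vgroupM (v : vertex Y) (a b : vgroup v) :
  in_vgroup S (a * b) = in_vgroup S a * in_vgroup S b.
Proof.
rewrite /in_vgroup -gmulfM; congr (spi1 S _).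
rewrite [RHS](pi1_mulE _ [:: vletter a] [:: vletter b]).
exact/pi1_classP/word_rel_sym/word_rel_mul.
Qed.

Lemma in_vgroup1 (v : vertex Y) : in_vgroup S (1 : vgroup v) = 1.
Proof. by apply: (mulgI (in_vgroup S (1 : vgroup v))); rewrite -in_vgroupM !mulg1. Qed.

Lemma in_vgroupV (v : vertex Y) (a : vgroup v) :
  in_vgroup S a^-1 = (in_vgroup S a)^-1.
Proof.
by apply: (mulgI (in_vgroup S a)); rewrite -in_vgroupM !mulgV in_vgroup1.
Qed.

Lemma stable_letterP (e : edge Y) (c : egroup e) :
  in_vgroup S (att_src e c) * stable_letter S e =
  stable_letter S e * in_vgroup S (att_tgt e c).
Proof.
rewrite /in_vgroup /stable_letter -!gmulfM; congr (spi1 S _).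
rewrite [LHS](pi1_mulE _ [:: vletter _] [:: eletter e true]).
rewrite [RHS](pi1_mulE _ [:: eletter e true] [:: vletter _]).
apply/pi1_classP.
apply: (@word_rel_trans _ _ _ ([:: eletter e true; vletter (att_tgt e c);
  eletter e false] ++ [:: eletter e true])).
  apply: word_rel_cat; last exact: word_rel_refl.
  exact/word_rel_sym/word_rel_edge.
rewrite -[_ ++ _]/([:: eletter e true; vletter (att_tgt e c)] ++
  [:: eletter e false; eletter e true]) -[X in word_rel _ _ X]cats0.
apply: word_rel_cat; first exact: word_rel_refl.
exact: (word_rel_stable _ e false).
Qed.

Lemma vimage_translate (v : vertex Y) (h : G) :
  vimage S v h -> translate h (vimage S v) = vimage S v.
Proof.
move=> [a _ <-]; apply/seteqP; split=> x; rewrite /translate /=.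
  move=> [b _ hb]; exists (a * b) => //.
  by rewrite in_vgroupM hb mulgA mulgV mul1g.
by move=> [b _ <-]; exists (a^-1 * b) => //; rewrite in_vgroupM in_vgroupV.
Qed.

Definition src_coset (y : edge Y * set G) : set G :=
  [set x | exists2 c, y.2 c & translate c (vimage S (esrc y.1)) x].

Definition tgt_coset (y : edge Y * set G) : set G :=
  [set x | exists2 c, y.2 c &
     translate (c * stable_letter S y.1) (vimage S (etgt y.1)) x].

Lemma eimage1 e : eimage S e 1.
Proof.
exists 1 => //; rewrite (_ : att_src e 1 = 1) ?in_vgroup1 //.
by apply: (mulgI (att_src e 1)); rewrite -gmulfM !mulg1.
Qed.

Lemma src_cosetE (e : edge Y) (g : G) :
  src_coset (e, translate g (eimage S e)) = translate g (vimage S (esrc e)).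
Proof.
apply/seteqP; split=> x /=.
  move=> [c [d _ hd]]; rewrite -(mulKVg g c) -hd translateM vimage_translate //.
  by exists (att_src e d).
by move=> hx; exists g => //; rewrite /translate /= mulVg; exact: eimage1.
Qed.

Lemma tgt_cosetE (e : edge Y) (g : G) :
  tgt_coset (e, translate g (eimage S e)) =
  translate (g * stable_letter S e) (vimage S (etgt e)).
Proof.
apply/seteqP; split=> x /=.
  move=> [c [d _ hd]].
  rewrite -(mulKVg g c) -hd -mulgA stable_letterP mulgA.
  rewrite [translate (_ * _ * _) _]translateM.
  by rewrite vimage_translate //; exists (att_tgt e d).
by move=> hx; exists g => //; rewrite /translate /= mulVg; exact: eimage1.
Qed.

Lemma bs_src_proof (y : bs_edge) :
  exists g, src_coset (sval y) = translate g (vimage S (esrc (sval y).1)).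
Proof. by case: y => [[e C] /= [g ->]]; exists g; exact: src_cosetE. Qed.

Lemma bs_tgt_proof (y : bs_edge) :
  exists g, tgt_coset (sval y) = translate g (vimage S (etgt (sval y).1)).
Proof.
case: y => [[e C] /= [g ->]]; exists (g * stable_letter S e).
exact: tgt_cosetE.
Qed.

Definition bs_src (y : bs_edge) : bs_vertex :=
  exist _ (esrc (sval y).1, src_coset (sval y)) (bs_src_proof y).

Definition bs_tgt (y : bs_edge) : bs_vertex :=
  exist _ (etgt (sval y).1, tgt_coset (sval y)) (bs_tgt_proof y).

Lemma bs_vact1 x : bs_vact 1 x = x.
Proof.
by apply: bs_vertex_eq; rewrite /= translate1 -surjective_pairing.
Qed.

Lemma bs_vactM g h x : bs_vact (g * h) x = bs_vact g (bs_vact h x).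
Proof. by apply: bs_vertex_eq; rewrite /= translateM. Qed.

Lemma bs_eact1 y : bs_eact 1 y = y.
Proof. by apply: bs_edge_eq; rewrite /= translate1 -surjective_pairing. Qed.

Lemma bs_eactM g h y : bs_eact (g * h) y = bs_eact g (bs_eact h y).
Proof. by apply: bs_edge_eq; rewrite /= translateM. Qed.

Lemma bs_src_act g y : bs_src (bs_eact g y) = bs_vact g (bs_src y).
Proof.
apply: bs_vertex_eq => /=; congr (_, _).
by case: y => [[e C] /= [h ->]]; rewrite -translateM !src_cosetE translateM.
Qed.

Lemma bs_tgt_act g y : bs_tgt (bs_eact g y) = bs_vact g (bs_tgt y).
Proof.
apply: bs_vertex_eq => /=; congr (_, _).
case: y => [[e C] /= [h ->]].
by rewrite -translateM !tgt_cosetE -[RHS]translateM mulgA.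
Qed.

Definition bass_serre : Ggraph G :=
  GGraph bs_vact1 bs_vactM bs_eact1 bs_eactM bs_src_act bs_tgt_act.

End BassSerre.

(* Y is the quotient graph of groups of the action of H on X: its vertices    *)
(* and edges index the H-orbits, with chosen representatives [qvert] and      *)
(* [qedge]; its groups are their H-stabilizers; the endpoints of the chosen   *)
(* edge [qedge e] are carried from the chosen vertices by elements of H, and  *)
(* the attaching maps are the inclusions of stabilizers conjugated            *)
(* accordingly (recall x ^ g = g^-1 * x * g).                                 *)
Record quotient_gog (G : groupType) (X : Ggraph G) (H : set G)
    (Y : graph_of_groups) := QuotientGog {
  qvert : vertex Y -> gvert X;
  qedge : edge Y -> gedge X;
  qvertP : forall x, exists! v, exists2 h, H h & vact h (qvert v) = x;
  qedgeP : forall y, exists! e, exists2 h, H h & eact h (qedge e) = y;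
  qvgroup : forall v, {multiplicative vgroup v -> G};
  qegroup : forall e, {multiplicative egroup e -> G};
  qvgroup_inj : forall v, injective (qvgroup v);
  qegroup_inj : forall e, injective (qegroup e);
  qvgroupP : forall v,
    range (qvgroup v) = [set h | H h /\ vact h (qvert v) = qvert v];
  qegroupP : forall e,
    range (qegroup e) = [set h | H h /\ eact h (qedge e) = qedge e];
  qsrc : edge Y -> G;
  qtgt : edge Y -> G;
  qsrc_in : forall e, H (qsrc e);
  qtgt_in : forall e, H (qtgt e);
  qsrcP : forall e, gsrc (qedge e) = vact (qsrc e) (qvert (esrc e));
  qtgtP : forall e, gtgt (qedge e) = vact (qtgt e) (qvert (etgt e));
  qatt_src : forall e c, qvgroup (esrc e) (att_src e c) = qegroup e c ^ qsrc e;
  qatt_tgt : forall e c, qvgroup (etgt e) (att_tgt e c) = qegroup e c ^ qtgt e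
}.

Definition is_induced_splitting (G : groupType) (S : splitting G) (H : set G)
  (Y : graph_of_groups) : Prop := inhabited (quotient_gog (bass_serre S) H Y).

Definition virtually_primitive (G : groupType) (S : splitting G) : Prop :=
  exists (H : set G) (Y : graph_of_groups),
    [/\ is_subgroup H, finite_index H, is_induced_splitting S H Y,
        is_tubular Y & is_primitive Y].

(* Main.v *)
From HB Require Import structures.
Require Import Defs.
From mathcomp Require Import fingroup perm all_boot ssralg ssrnum ssrint order intdiv.
From mathcomp Require Import boolp classical_sets functions cardinality.
From mathcomp Require Import ring zify.

Set Implicit Arguments.
Unset Strict Implicit.
Unset Printing Implicit Defensive.

Local Open Scope group_scope.
Local Open Scope classical_set_scope.

(** Call a normal subgroup [N] of finite index rooted if every element of [N] in
    a vertex group that has a positive power in an adjacent edge group lies in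
    that edge group.  The vertex groups of the splitting induced on [N] are
    lattices of rank two, and a nontrivial cyclic subgroup of such a lattice is
    maximal cyclic exactly when it contains the roots of its elements
    ([maximal_cyclic_isolated], [isolated_maximal_cyclic]); so the induced
    splitting is primitive when [N] is rooted, and conversely the normal core of
    a subgroup with primitive induced splitting is rooted ([primitive_roots],
    [induced_primitive]).  The theorem thus compares residual finiteness with
    the existence of a rooted subgroup.

    Suppose that the group is residually finite.  A root [a] of an edge group
    element need not lie in the edge group, but up to the edge group it is one
    of finitely many elements [z].  The edge group is centralized by the group
    of the adjacent vertex, conjugated across the edge, whereas [z] does not
    commute with an element of that conjugate outside the edge group, by
    Britton's lemma.  A normal subgroup that avoids these finitely many
    nontrivial commutators is rooted ([rooted_subgroup]).

    Suppose that [N] is rooted.  Divide each vertex group by the [n]-th powers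
    of its elements that lie in [N].  As [N] is rooted, the two subgroups that
    appear in an edge group from its two ends coincide ([vertex_powers_edge]),
    so the quotients form a graph of finite groups.  A nontrivial element is
    the class of a reduced route, and since cyclic subgroups of lattices are
    separable ([cyclic_separable]) it stays reduced for a suitable [n].

    Both directions need that a reduced route acts nontrivially somewhere, on a
    finite set when the vertex groups have been made finite.  One construction
    serves for both ([reduced_route_acts]): on a set where all vertex groups act
    with the prescribed kernels, it is enough to choose for each edge a
    permutation that conjugates the two actions of the edge group.  Such
    permutations exist ([square_intertwiner]), can be prescribed on finitely
    many points in distinct orbits ([extend_intertwiner]), and the points
    visited by a reduced route are in distinct orbits.  The letters of the
    spanning tree are made trivial by a change of gauge ([tree_gauge]).  With
    trivial kernels this is Britton's lemma ([reduced_route_neq1]). *)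

(** * Morphisms and subgroups *)

Section Morphisms.
Variables (A B : groupType) (f : {multiplicative A -> B}).

Lemma morph1 : f 1 = 1.
Proof. by apply: (mulgI (f 1)); rewrite -gmulfM !mulg1. Qed.

Lemma morphV : {morph f : x / x^-1}.
Proof. by move=> x; apply: (mulgI (f x)); rewrite -gmulfM !mulgV morph1. Qed.

Lemma morphX n : {morph f : x / x ^+ n}.
Proof. by elim: n => [|n IHn] x; rewrite ?morph1 // !expgS gmulfM IHn. Qed.

Lemma morphJ : {morph f : x y / x ^ y}.
Proof. by move=> x y; rewrite !conjgE !gmulfM morphV. Qed.

End Morphisms.

Definition to_morphism (A B : groupType) (f : A -> B)
    (fM : {morph f : x y / x * y}) : {multiplicative A -> B} :=
  HB.pack f (isMultiplicative.Build A B f fM).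

Lemma zmod_morph0 (I : zmodType) (A : groupType) (h : I -> A) :
  {morph h : x y / (x + y)%R >-> x * y} -> h 0%R = 1.
Proof. by move=> hD; apply: (mulgI (h 0%R)); rewrite -hD GRing.addr0 mulg1. Qed.

Lemma inj_surj_bijective (T U : Type) (g : T -> U) :
  injective g -> (forall y, exists x, g x = y) -> bijective g.
Proof.
move=> g_inj /choice [h hK]; exists h => // x; apply: g_inj; exact: hK.
Qed.

Lemma conj_morphism (A B : groupType) (F : {multiplicative A -> B}) (t : B) :
  exists F' : {multiplicative A -> B}, forall a, F' a = F a ^ t.
Proof.
pose f a := F a ^ t.
have fM : {morph f : a b / a * b} by move=> a b; rewrite /f gmulfM conjMg.
by exists (to_morphism fM).
Qed.

Lemma bijective_morphism_inverse (A B : groupType) (h : {multiplicative A -> B}) :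
  bijective h -> exists h' : {multiplicative B -> A}, cancel h h' /\ cancel h' h.
Proof.
move=> [g hK gK].
have gM : {morph g : x y / x * y} by exact: can2_gmulfM.
by exists (to_morphism gM).
Qed.

Lemma morphism_factor (A B C : groupType) (h : {multiplicative B -> A})
    (k : {multiplicative C -> A}) :
  injective h -> range k `<=` range h ->
  exists k' : {multiplicative C -> B}, forall c, h (k' c) = k c.
Proof.
move=> h_inj kh.
have /choice [f fE] : forall c, exists b, h b = k c.
  by move=> c; have [|b _ bE] := kh (k c); [exists c | exists b].
have fM : {morph f : x y / x * y}.
  by move=> x y; apply: h_inj; rewrite gmulfM !fE gmulfM.
by exists (to_morphism fM).
Qed.

Section Subgroups.
Variables (A : groupType) (H : set A).
Hypothesis sgH : is_subgroup H.

Lemma sub1 : H 1. Proof. exact: sgH.1. Qed.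
Lemma subF x y : H x -> H y -> H (x / y). Proof. exact: sgH.2. Qed.
Lemma subV x : H x -> H x^-1.
Proof. by move=> Hx; rewrite -div1g; apply: subF => //; exact: sub1. Qed.
Lemma subM x y : H x -> H y -> H (x * y).
Proof. by move=> Hx Hy; rewrite -[y]invgK; apply: subF => //; exact: subV. Qed.
Lemma subX n x : H x -> H (x ^+ n).
Proof. by move=> Hx; elim: n => [|n IHn]; [exact: sub1 | rewrite expgS; exact: subM]. Qed.
Lemma subVE x : H x^-1 -> H x.
Proof. by move/subV; rewrite invgK. Qed.

End Subgroups.

Lemma range_subgroup (A B : groupType) (f : {multiplicative A -> B}) :
  is_subgroup (range f).
Proof.
split; first by exists 1 => //; rewrite morph1.
by move=> _ _ [a _ <-] [b _ <-]; exists (a / b) => //; rewrite gmulfM morphV.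
Qed.

Lemma subgroup_group (G : groupType) (L : set G) : is_subgroup L ->
  exists (B : groupType) (h : {multiplicative B -> G}), injective h /\ range h = L.
Proof.
move=> sgL.
pose T := {x : G | `[<L x>]}.
pose one : T := exist _ 1 (asboolT (sub1 sgL)).
pose mul (x y : T) : T := exist _ (sval x * sval y)
  (asboolT (subM sgL (asboolW (svalP x)) (asboolW (svalP y)))).
pose inv (x : T) : T := exist _ (sval x)^-1 (asboolT (subV sgL (asboolW (svalP x)))).
have mulA : associative mul by move=> x y z; apply: val_inj; exact: mulgA.
have mul1 : left_id one mul by move=> x; apply: val_inj; exact: mul1g.
have mulr1 : right_id one mul by move=> x; apply: val_inj; exact: mulg1.
have mulV : left_inverse one inv mul by move=> x; apply: val_inj; exact: mulVg.
have mulrV : right_inverse one inv mul by move=> x; apply: val_inj; exact: mulgV.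
pose grpT := isGroup.Build T mulA mul1 mulr1 mulV mulrV.
pose B : groupType := HB.pack T grpT.
have hM : {morph (fun x : B => sval (x : T)) : x y / x * y} by [].
exists B, (to_morphism hM); split; first by move=> x y; exact: val_inj.
apply/seteqP; split=> [_ [x _ <-]|x Lx]; first exact: asboolW (svalP (x : T)).
by exists (exist _ x (asboolT Lx)).
Qed.

Lemma powersE (A : groupType) (h : int -> A) :
  {morph h : x y / (x + y)%R >-> x * y} -> powers (h 1%R) = range h.
Proof.
move=> hD.
have h0 := zmod_morph0 hD.
have hV i : h (- i)%R = (h i)^-1.
  by apply: (mulgI (h i)); rewrite -hD GRing.subrr mulgV.
have hn (n : nat) : h n = h 1%R ^+ n.
  by elim: n => // n IHn; rewrite expgS -IHn -hD; congr h; lia.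
apply/seteqP; split=> x /=.
  case=> n [->|->]; first by exists (n : int).
  by exists (- (n : int))%R; rewrite // hV -hn.
case=> [[n|n] _ <-]; first by exists n; left; rewrite -hn.
by exists n.+1; right; rewrite -hn -hV; congr h; lia.
Qed.

Lemma powers_subgroup (A : groupType) (a : A) : is_subgroup (powers a).
Proof.
have cm m n : commute (a ^+ m) (a ^+ n) by rewrite /commute -!expgnDr addnC.
have pF m n : powers a (a ^+ m / a ^+ n).
  case: (leqP n m) => [le_nm|/ltnW le_mn].
    by exists (m - n)%N; left; rewrite expgnFr.
  by exists (n - m)%N; right; rewrite expgnFr // invgF.
split; first by exists 0%N; left.
move=> _ _ [m [->|->]] [n [->|->]] //; rewrite ?invgK.
- by exists (m + n)%N; left; rewrite expgnDr.
- by exists (n + m)%N; right; rewrite expgnDr invgM.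
- by rewrite -(commuteV (cm n m)).
Qed.

(** A generator of a cyclic overgroup of [C] has a nontrivial power in [C], so
    it already lies in [C]. Without a nontrivial element [C] could be trivial,
    which is isolated in a torsion-free group but not maximal cyclic. *)
Lemma isolated_maximal_cyclic (A : groupType) (C : set A) :
  is_cyclic C -> (exists2 c, C c & c <> 1) ->
  (forall x j, (0 < j)%N -> C (x ^+ j) -> C x) -> is_maximal_cyclic C.
Proof.
move=> cC [c Cc c1] isoC; split=> // D [d ->] CD.
have sgC : is_subgroup C by case: cC => a ->; exact: powers_subgroup.
apply/seteqP; split=> //.
have Cd : C d.
  have [[|n] dn] := CD _ Cc; first by case: dn c1 => -> /(_ _) [] //; rewrite ?invg1.
  apply: (isoC _ n.+1) => //; case: dn Cc => -> // Cdn.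
  exact: subVE.
by move=> _ [n [->|->]]; [exact: subX | apply: subV => //; exact: subX].
Qed.

(** * Subgroups of the free abelian groups of rank one and two *)

Section Lattices.
Variables (A : groupType) (f : int * int -> A).
Hypotheses (f_bij : bijective f) (fD : {morph f : x y / (x + y)%R >-> x * y}).

Lemma lattice_inj : injective f. Proof. exact: bij_inj. Qed.

Lemma lattice_surj (x : A) : exists a, x = f a.
Proof. by case: f_bij => g _ fK; exists (g x). Qed.

Lemma lattice0 : f (0, 0)%R = 1. Proof. exact: zmod_morph0 fD. Qed.

Lemma latticeX n a : f a ^+ n = f (n%:Z * a.1, n%:Z * a.2)%R.
Proof.
elim: n => [|n IHn]; first by rewrite !GRing.mul0r lattice0.
rewrite expgS IHn -fD; congr f; case: a {IHn} => a b /=.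
by congr (_, _) => /=; lia.
Qed.

Lemma lattice_powers a : powers (f a) = range (fun i => f (i * a.1, i * a.2)%R).
Proof.
rewrite -powersE; first by congr powers; rewrite !GRing.mul1r; case: a.
by move=> i j; rewrite -fD; congr f; congr (_, _); rewrite GRing.mulrDl.
Qed.

Lemma lattice_comm (x y : A) : x * y = y * x.
Proof.
have [a ->] := lattice_surj x; have [b ->] := lattice_surj y.
by rewrite -!fD GRing.addrC.
Qed.

Lemma lattice_pow_eq1 (x : A) n : (0 < n)%N -> x ^+ n = 1 -> x = 1.
Proof.
move=> n0; have [a ->] := lattice_surj x.
rewrite latticeX -lattice0 => /lattice_inj [E1 E2].
by congr f; case: a E1 E2 => a b /= E1 E2; congr (_, _); nia.
Qed.

End Lattices.

(** A nonzero vector [a] is [k] times a vector [p] with coprime coordinates.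
    Bezout coefficients [u] of [p] recover the coefficient of any vector that is
    parallel to [a], which turns proportionality of vectors into divisibility
    of integers. *)
Lemma primitive_vector (a : int * int) : a <> (0, 0)%R ->
  exists (k : nat) (p u : int * int), [/\ (0 < k)%N,
    a = (k%:Z * p.1, k%:Z * p.2)%R, (u.1 * p.1 + u.2 * p.2 = 1)%R &
    forall x : int * int, (x.1 * a.2 = x.2 * a.1)%R ->
      x = ((u.1 * x.1 + u.2 * x.2) * p.1, (u.1 * x.1 + u.2 * x.2) * p.2)%R].
Proof.
case: a => a b ab0.
have [[u v] Euv] : exists uv : int * int, (uv.1 * a + uv.2 * b = gcdz a b)%R.
  by have [u [v E]] := Bezoutz a b; exists (u, v).
have g0 : gcdz a b <> 0%R.
  by move/eqP; rewrite gcdz_eq0 => /andP[/eqP E1 /eqP E2]; apply: ab0; rewrite E1 E2.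
have [p Ep] : exists p, (a = gcdz a b * p)%R.
  by have /dvdzP[p E] := dvdz_gcdl a b; exists p; rewrite GRing.mulrC.
have [q Eq] : exists q, (b = gcdz a b * q)%R.
  by have /dvdzP[q E] := dvdz_gcdr a b; exists q; rewrite GRing.mulrC.
have k0 : (0 < absz (gcdz a b))%N by rewrite absz_gt0; exact/eqP.
exists (absz (gcdz a b)), (p, q), (u, v) => /=.
have gE : (absz (gcdz a b) : int) = gcdz a b by [].
rewrite gE -Ep -Eq; move: (gcdz a b) g0 gE Ep Eq Euv => g g0 gE Ep Eq /= Euv.
have E1 : (u * p + v * q = 1)%R.
  by apply: (@GRing.mulfI _ g); [exact/eqP | rewrite Ep Eq in Euv; lia].
split=> //.
case=> x y /=; rewrite Ep Eq => E.
have {}E : (x * q = y * p)%R by apply: (@GRing.mulfI _ g); [exact/eqP | lia].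
have E2 : (x = (u * x + v * y) * p)%R.
  rewrite GRing.mulrDl -[X in (_ + X)%R]GRing.mulrA -E.
  by rewrite -[LHS]GRing.mulr1 -E1; ring.
rewrite {1}E2; congr (_, _).
rewrite GRing.mulrDl -(GRing.mulrA u) E.
by rewrite -[LHS]GRing.mulr1 -E1; ring.
Qed.

Lemma parallel_of_multiple (z a : int * int) (j : nat) i : (0 < j)%N ->
  (j%:Z * z.1 = i * a.1)%R -> (j%:Z * z.2 = i * a.2)%R ->
  (z.1 * a.2 = z.2 * a.1)%R.
Proof.
move=> j0 E1 E2; apply: (@GRing.mulfI _ j%:Z); first by case: j j0 {E1 E2}.
by rewrite !GRing.mulrA E1 E2; ring.
Qed.

Lemma small_multiple (n : nat) (w : int) :
  (absz (n%:Z * w)%R < n)%N -> (n%:Z * w = 0)%R.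
Proof.
rewrite abszM /= => lt_n; have [->|w0] := eqVneq w 0%R; first by rewrite GRing.mulr0.
by move: lt_n; rewrite ltnNge leq_pmulr // absz_gt0.
Qed.

Section LatticeSubgroups.
Variables (A : groupType) (f : int * int -> A).
Hypotheses (f_bij : bijective f) (fD : {morph f : x y / (x + y)%R >-> x * y}).

Lemma maximal_cyclic_isolated (C : set A) (x : A) j :
  is_maximal_cyclic C -> (0 < j)%N -> C (x ^+ j) -> C x.
Proof.
move=> [[c ->] maxC] j0.
have [a ca] := lattice_surj f_bij c; rewrite {c}ca in maxC *.
have [z ->] := lattice_surj f_bij x.
have [->|/eqP a0] := eqVneq a (0, 0)%R.
  rewrite lattice_powers //= => -[i _]; rewrite !GRing.mulr0 (lattice0 fD) => E.
  exists 0%R => //=; rewrite !GRing.mulr0 (lattice0 fD).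
  by rewrite (lattice_pow_eq1 f_bij fD j0 (esym E)).
have [k [p [u [k0 Ea Eu par]]]] := primitive_vector a0.
(* By maximality the generator is itself primitive. *)
have <- : powers (f p) = powers (f a).
  apply: maxC; first by exists (f p).
  rewrite !lattice_powers // => _ [i _ <-]; exists (i * k%:Z)%R => //.
  by rewrite Ea /= !GRing.mulrA.
rewrite !lattice_powers //= latticeX // => -[i _ /(lattice_inj f_bij) [E1 E2]].
exists (u.1 * z.1 + u.2 * z.2)%R => //; rewrite -par //.
rewrite Ea /= GRing.mulrCA.
by rewrite (parallel_of_multiple j0 (esym E1) (esym E2)) GRing.mulrCA.
Qed.

(** If [C] is generated by [k] times a primitive vector [p], the roots of
    elements of [C] are the multiples of [p], so those outside [C] are covered
    by the cosets of [p], ..., [(k - 1) p]. Finitely many elements therefore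
    control all roots. *)
Lemma isolator_cosets (C : set A) :
  is_cyclic C -> (exists2 c, C c & c <> 1) ->
  exists (k : nat) (z : nat -> A), (forall i, (i < k)%N -> ~ C (z i)) /\
    forall x j, (0 < j)%N -> C (x ^+ j) -> ~ C x ->
      exists i c, [/\ (i < k)%N, C c & x = z i * c].
Proof.
move=> [c ->] [c' Cc' c'1].
have [a ca] := lattice_surj f_bij c; rewrite {c}ca in Cc' *.
have a0 : a <> (0, 0)%R.
  move=> a0; move: Cc'; rewrite lattice_powers // a0 => -[i _] /=.
  by rewrite !GRing.mulr0 (lattice0 fD) => /esym.
have [k [p [u [k0 Ea Eu par]]]] := primitive_vector a0.
exists k.-1, (fun i => f (i.+1%:Z * p.1, i.+1%:Z * p.2)%R); split.
  move=> i ik; rewrite lattice_powers // => -[l _ /(lattice_inj f_bij)].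
  rewrite Ea /= => -[E1 E2].
  have E : (i.+1%:Z = l * k%:Z)%R.
    rewrite -[LHS]GRing.mulr1 -[RHS]GRing.mulr1 -Eu.
    by rewrite !GRing.mulrDr (GRing.mulrCA _ u.1) (GRing.mulrCA _ u.2) -E1 -E2; ring.
  have l1 : (l <= 0 \/ 1 <= l)%R by lia.
  by case: l1 => l1; nia.
move=> x j j0; have [z ->] := lattice_surj f_bij x.
rewrite !lattice_powers //= latticeX // => -[i _ /(lattice_inj f_bij) [E1 E2]].
have /par zE : (z.1 * a.2 = z.2 * a.1)%R by exact: parallel_of_multiple j0 (esym E1) (esym E2).
move: (u.1 * z.1 + _)%R zE => l zE nC.
have lE := divz_eq l k%:Z.
have r0 : (0 <= l %% k%:Z)%Z%R by apply: modz_ge0; lia.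
have rk : (l %% k%:Z < k%:Z)%Z%R by apply: ltz_pmod; lia.
move: (l %% _)%Z (l %/ _)%Z lE r0 rk => r q lE r0 rk.
have rn0 : r <> 0%R.
  move=> r00; apply: nC; exists q => //; congr f.
  by rewrite zE Ea lE r00 /= GRing.addr0 !GRing.mulrA.
exists (absz r).-1, (f (q * a.1, q * a.2)%R); split; first by lia.
  by exists q.
rewrite -fD zE; congr f; rewrite Ea /= lE.
have -> : Posz (absz r).-1.+1 = r by lia.
by congr (_, _) => /=; ring.
Qed.

(** Cyclic subgroups of the rank two lattice are closed in its profinite
    topology, uniformly in all multiples of one modulus. The determinant of [x]
    and a generator [a] of [C] vanishes modulo [n] on [C] plus [n] times the
    lattice, so it separates when it is nonzero; when it vanishes, [x] and [a]
    are multiples of one primitive vector, and the multiple that [a] is separates. *)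
Lemma cyclic_separable (C : set A) (x : A) : is_cyclic C -> ~ C x ->
  exists2 n0, (0 < n0)%N &
    forall n c y, (0 < n)%N -> n0 %| n -> C c -> x <> c * y ^+ n.
Proof.
move=> [c ->]; have [a ->] := lattice_surj f_bij c.
have [z ->] := lattice_surj f_bij x => nC.
have [a0|/eqP a0] := eqVneq a (0, 0)%R.
  rewrite {a}a0 in nC *.
  have z0 : z <> (0, 0)%R.
    by move=> z0; apply: nC; rewrite z0 (lattice0 fD); exists 0%N; left.
  exists (absz z.1 + absz z.2).+1 => // n c' y n0 dvd; rewrite lattice_powers //.
  case=> i _ <-; have [w ->] := lattice_surj f_bij y.
  rewrite latticeX // !GRing.mulr0 -fD => /(lattice_inj f_bij) E.
  have lt_n : ((absz z.1 + absz z.2).+1 <= n)%N by exact: dvdn_leq.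
  apply: z0; case: z E {nC dvd} lt_n => z1 z2 [/= -> ->]; rewrite !GRing.add0r => lt_n.
  by congr (_, _); apply: small_multiple; lia.
have [E|/eqP D0] := eqVneq (z.1 * a.2)%R (z.2 * a.1)%R.
  have [k [p [u [k0 Ea Eu par]]]] := primitive_vector a0.
  have zE := par _ E; exists k => // n c' y n0 dvd; rewrite lattice_powers //.
  case=> i _ <-; have [w ->] := lattice_surj f_bij y.
  rewrite latticeX // -fD => /(lattice_inj f_bij) Ez.
  have kd : (k%:Z %| (u.1 * z.1 + u.2 * z.2)%R)%Z.
    have /dvdnP[q nE] := dvd.
    apply/dvdzP; exists (i + q%:Z * (u.1 * w.1 + u.2 * w.2))%R.
    by rewrite Ez Ea nE /= -[X in (X + q%:Z * _)%R]GRing.mulr1 -Eu PoszM; ring.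
  apply: nC; rewrite lattice_powers //; have /dvdzP[q qE] := kd.
  by exists q => //; rewrite zE qE Ea /= !GRing.mulrA.
exists (absz (z.1 * a.2 - z.2 * a.1)%R).+1 => // n c' y n0 dvd.
rewrite lattice_powers // => -[i _ <-]; have [w ->] := lattice_surj f_bij y.
rewrite latticeX // -fD => /(lattice_inj f_bij) Ez.
have lt_n := dvdn_leq n0 dvd.
have E : (z.1 * a.2 - z.2 * a.1 = n%:Z * (w.1 * a.2 - w.2 * a.1))%R.
  by rewrite Ez /=; ring.
by apply: D0; apply/eqP; rewrite -GRing.subr_eq0 E small_multiple // -E.
Qed.

Lemma cyclic_proper (C : set A) : is_cyclic C -> exists y, ~ C y.
Proof.
move=> [c ->]; have [a ->] := lattice_surj f_bij c.
apply/existsNP => all_C.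
have := all_C (f (1, 0)%R); have := all_C (f (0, 1)%R).
rewrite !lattice_powers // => -[i _ /(lattice_inj f_bij) [E1 E2]].
by move=> [j _ /(lattice_inj f_bij) [E3 E4]]; nia.
Qed.

End LatticeSubgroups.

Lemma int_subgroup (P : int -> Prop) m :
  (forall x y, P x -> P y -> P (x - y)%R) -> (0 < m)%N -> P (Posz m) ->
  exists2 d : nat, (0 < d)%N & forall x, P x <-> exists k, x = (k * (Posz d))%R.
Proof.
move=> PB m0 Pm.
have ex : exists n, `[< (0 < n)%N /\ P (Posz n) >] by exists m; apply/asboolP.
case: (ex_minnP ex) => d /asboolP[d0 Pd] minP {m m0 Pm ex}; exists d => //.
(* The least positive element generates, by Euclidean division. *)
have P0 : P 0%R by rewrite -(GRing.subrr (Posz d)); exact: PB.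
have PN x : P x -> P (- x)%R by move=> Px; rewrite -GRing.sub0r; exact: PB.
have Pk (k : nat) : P ((Posz k) * (Posz d))%R.
  elim: k => [|k IHk]; first by rewrite GRing.mul0r.
  have -> : ((Posz k.+1) * (Posz d) = (Posz k) * (Posz d) - - (Posz d))%R by lia.
  by apply: PB => //; exact: PN.
have {}Pk k : P (k * (Posz d))%R.
  case: k => // k; rewrite NegzE GRing.mulNr; exact: PN.
move=> x; split=> [Px|[k ->] //].
exists (x %/ (Posz d))%Z.
have xE := divz_eq x (Posz d).
have r0 : (0 <= x %% (Posz d))%Z%R by apply: modz_ge0; lia.
have rd : (x %% (Posz d) < (Posz d))%Z%R by apply: ltz_pmod; lia.
have Pr : P (x %% (Posz d))%Z.
  have -> : (x %% (Posz d))%Z = (x - (x %/ (Posz d))%Z * (Posz d))%R by rewrite {2}xE; ring.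
  exact: PB.
have [r00|/eqP rn0] := eqVneq (x %% (Posz d))%Z 0%R.
  by rewrite {1}xE r00 GRing.addr0.
have : (d <= absz (x %% (Posz d))%Z)%N.
  apply: minP; apply/asboolP; split; first by lia.
  by have -> : Posz (absz (x %% (Posz d))%Z) = (x %% (Posz d))%Z by lia.
lia.
Qed.

(** Stabilizers of an action are given as abstract groups with an embedding; a
    parametrization of the image transports back along the embedding. *)
Lemma embedded_parametrization (I : zmodType) (A B : groupType)
    (h : {multiplicative B -> A}) (g : I -> A) :
  injective h -> injective g -> {morph g : x y / (x + y)%R >-> x * y} ->
  range h = range g ->
  exists k : I -> B, bijective k /\ {morph k : x y / (x + y)%R >-> x * y}.
Proof.
move=> h_inj g_inj gD hg.
have /choice [k kE] : forall z, exists b, h b = g z.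
  move=> z; have : range h (g z) by rewrite hg; exists z.
  by case=> b _; exists b.
exists k; split; last by move=> x y; apply: h_inj; rewrite gmulfM !kE gD.
apply: inj_surj_bijective => [x y E|b]; first by apply: g_inj; rewrite -!kE E.
have : range g (h b) by rewrite -hg; exists b.
by case=> z _ E; exists z; apply: h_inj; rewrite kE.
Qed.

(** A finite index subgroup of the lattice has a triangular basis: [(0, d)]
    generates its intersection with the second axis, and [(a, b)] lies over a
    generator [a] of its projection to the first. *)
Lemma lattice_finite_index (A B : groupType) (h : {multiplicative B -> A}) m :
  isomorphic_to_Z2 A -> injective h -> (0 < m)%N ->
  (forall x, range h (x ^+ m)) -> isomorphic_to_Z2 B.
Proof.
move=> [f [f_bij fD]] h_inj m0 hm.
pose L := range h.
have sgL : is_subgroup L := range_subgroup h.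
have fB x y : f (x - y)%R = f x / f y.
  apply: (mulIg (f y)); rewrite mulgVK -fD; congr f.
  by rewrite GRing.addrNK.
have LB x y : L (f x) -> L (f y) -> L (f (x - y)%R).
  by move=> Lx Ly; rewrite fB; exact: subF.
have LX x : L (f ((Posz m) * x.1, (Posz m) * x.2)%R) by rewrite -latticeX //; exact: hm.
have [d d0 dP] : exists2 d : nat, (0 < d)%N &
    forall y, L (f (0, y)%R) <-> exists k, y = (k * (Posz d))%R.
  apply: (@int_subgroup _ m) => // [x y|]; first exact: LB.
  by have := LX (0, 1)%R; rewrite /= GRing.mulr0 GRing.mulr1.
have [a a0 aP] : exists2 a : nat, (0 < a)%N &
    forall x, (exists y, L (f (x, y)%R)) <-> exists k, x = (k * (Posz a))%R.
  apply: (@int_subgroup _ m) => // [x y [x' Lx] [y' Ly]|].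
    by exists (x' - y')%R; have := LB _ _ Lx Ly.
  by exists 0%R; have := LX (1, 0)%R; rewrite /= GRing.mulr0 GRing.mulr1.
have [b Lb] : exists b, L (f ((Posz a), b)%R).
  by apply/aP; exists 1%R; rewrite GRing.mul1r.
pose g (z : int * int) := f (z.1 * (Posz a), z.1 * b + z.2 * (Posz d))%R.
apply: (embedded_parametrization (g := g) h_inj) => [x y|x y|].
- move=> /(lattice_inj f_bij) []; case: x y => x1 x2 [y1 y2] /= E1.
  have -> : x1 = y1 by nia.
  by move=> E2; congr (_, _); nia.
- by rewrite /g -fD; congr f; congr (_, _) => /=; ring.
have Li i : L (f (i * (Posz a), i * b)%R).
  have : powers (f ((Posz a), b)) `<=` L.
    move=> _ [n [->|->]]; first exact: subX.
    by apply: subV => //; exact: subX.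
  by apply; rewrite lattice_powers //; exists i.
apply/seteqP; split=> [x Lx|_ [z _ <-]].
  have [[x1 x2] xE] := lattice_surj f_bij x; rewrite xE in Lx *.
  have [i iE] : exists i, x1 = (i * (Posz a))%R by apply/aP; exists x2.
  have [j jE] : exists j, (x2 - i * b = j * (Posz d))%R.
    apply/dP; have := LB _ _ Lx (Li i); rewrite iE.
    by congr (L (f _)); congr (_, _) => /=; ring.
  by exists (i, j) => //; rewrite /g /= -iE -jE; congr f; congr (_, _); ring.
have Lz : L (f (0, z.2 * (Posz d))%R) by apply/dP; exists z.2.
have := subM sgL (Li z.1) Lz; rewrite -fD /g.
by congr (L (f _)); congr (_, _) => /=; ring.
Qed.

Lemma infinite_cyclic_finite_index (A B : groupType)
    (h : {multiplicative B -> A}) m :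
  isomorphic_to_Z A -> injective h -> (0 < m)%N ->
  (forall x, range h (x ^+ m)) -> isomorphic_to_Z B.
Proof.
move=> [f [f_bij fD]] h_inj m0 hm.
have fB x y : f (x - y)%R = f x / f y.
  by apply: (mulIg (f y)); rewrite mulgVK -fD GRing.addrNK.
have f0 := zmod_morph0 fD.
have fX n : f (Posz n) = f 1%R ^+ n.
  by elim: n => // n IHn; rewrite expgS -IHn -fD; congr f; lia.
have [d d0 dP] : exists2 d : nat, (0 < d)%N &
    forall y, range h (f y) <-> exists k, y = (k * (Posz d))%R.
  apply: (@int_subgroup _ m) => // [x y Lx Ly|]; last by rewrite fX; exact: hm.
  by rewrite fB; apply: subF => //; exact: range_subgroup.
apply: (embedded_parametrization (g := fun z => f (z * (Posz d))%R) h_inj).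
- by move=> x y /(bij_inj f_bij) E; nia.
- by move=> x y; rewrite -fD GRing.mulrDl.
apply/seteqP; split=> [x Lx|_ [z _ <-]]; last by apply/dP; exists z.
have [g _ fK] := f_bij.
have [k kE] : exists k, g x = (k * (Posz d))%R by apply/dP; rewrite fK.
by exists k => //; rewrite -kE fK.
Qed.

Lemma infinite_cyclic_range (A B : groupType) (h : {multiplicative A -> B}) :
  isomorphic_to_Z A -> is_cyclic (range h).
Proof.
move=> [f [[g _ fK] fD]]; exists (h (f 1%R)).
rewrite (@powersE _ (h \o f)); last by move=> x y /=; rewrite fD gmulfM.
apply/seteqP; split=> [_ [a _ <-]|_ [z _ <-]]; last by exists (f z).
by exists (g a) => //=; rewrite fK.
Qed.

(** * Permutation groups and finite quotients *)

(** Bijections are paired with their inverses so that the type is a group for an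
    arbitrary [P], finite or not: the same construction yields the infinite
    actions behind the normal form theorem and the finite ones behind residual
    finiteness. *)
Definition Sym (P : Type) :=
  {s : (P -> P) * (P -> P) | cancel s.1 s.2 /\ cancel s.2 s.1}.

HB.instance Definition _ (P : Type) := gen_eqMixin (Sym P).
HB.instance Definition _ (P : Type) := gen_choiceMixin (Sym P).

Section SymGroup.
Variable P : Type.
Implicit Types s t u : Sym P.

Definition app s : P -> P := (sval s).1.

Lemma app_inj s t : app s =1 app t -> s = t.
Proof.
case: s t => [[f g] [/= fK gK]] [[f' g'] [/= fK' gK']]; rewrite /app /=.
move=> /funext Ef; subst f'; apply: eq_exist => /=; congr (_, _).
by apply/funext => x; rewrite -{1}(gK' x) fK.
Qed.

Definition sym_one : Sym P := exist _ (id, id) (conj (frefl _) (frefl _)).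

Lemma sym_inv_proof s : cancel (sval s).2 (sval s).1 /\ cancel (sval s).1 (sval s).2.
Proof. by case: s => [[f g] []]. Qed.

Definition sym_inv s : Sym P :=
  exist _ ((sval s).2, (sval s).1) (sym_inv_proof s).

Lemma sym_mul_proof s t :
  cancel ((sval s).1 \o (sval t).1) ((sval t).2 \o (sval s).2) /\
  cancel ((sval t).2 \o (sval s).2) ((sval s).1 \o (sval t).1).
Proof.
case: s t => [[f g] [/= fK gK]] [[f' g'] [/= fK' gK']].
by split=> x /=; rewrite ?fK ?gK' ?fK' ?gK.
Qed.

Definition sym_mul s t : Sym P :=
  exist _ ((sval s).1 \o (sval t).1, (sval t).2 \o (sval s).2)
    (sym_mul_proof s t).

Lemma sym_mulA : associative sym_mul.
Proof. by move=> s t u; exact: app_inj. Qed.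
Lemma sym_mul1g : left_id sym_one sym_mul.
Proof. by move=> s; exact: app_inj. Qed.
Lemma sym_mulg1 : right_id sym_one sym_mul.
Proof. by move=> s; exact: app_inj. Qed.
Lemma sym_mulVg : left_inverse sym_one sym_inv sym_mul.
Proof. by move=> s; apply: app_inj => x; exact: (sym_inv_proof s).2. Qed.
Lemma sym_mulgV : right_inverse sym_one sym_inv sym_mul.
Proof. by move=> s; apply: app_inj => x; exact: (sym_inv_proof s).1. Qed.

HB.instance Definition _ :=
  isGroup.Build (Sym P) sym_mulA sym_mul1g sym_mulg1 sym_mulVg sym_mulgV.

Lemma appM s t x : app (s * t) x = app s (app t x). Proof. by []. Qed.
Lemma app1 x : app 1 x = x. Proof. by []. Qed.
Lemma appK s : cancel (app s) (app s^-1).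
Proof. by move=> x; rewrite -appM mulVg. Qed.
Lemma appKV s : cancel (app s^-1) (app s).
Proof. by move=> x; rewrite -appM mulgV. Qed.
Lemma app_injective s : injective (app s). Proof. exact: can_inj (appK s). Qed.

Lemma bijection_sym (f : P -> P) : bijective f -> exists s, app s = f.
Proof. by case=> g fK gK; exists (exist _ (f, g) (conj fK gK)). Qed.

End SymGroup.

Definition finitely_many (T : Type) := exists (F : finType) (f : T -> F), injective f.

Lemma finitely_many_prod (T U : Type) :
  finitely_many T -> finitely_many U -> finitely_many (T * U).
Proof.
move=> [F [f fI]] [F' [f' fI']]; exists (F * F')%type, (fun x => (f x.1, f' x.2)).
by move=> [x y] [x' y'] /= [/fI -> /fI' ->].
Qed.

Lemma finitely_many_fin (F : finType) : finitely_many F.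
Proof. by exists F, id. Qed.

Lemma finitely_many_forall (V : finType) (X : V -> Type) :
  (forall v, finitely_many (X v)) -> finitely_many (forall v, X v).
Proof.
move=> fX; pose F v := projT1 (cid (fX v)).
pose f v : X v -> F v := projT1 (cid (projT2 (cid (fX v)))).
have fI v : injective (f v) := projT2 (cid (projT2 (cid (fX v)))).
exists {dffun forall v, F v}, (fun m => [ffun v => f v (m v)]).
move=> m m' E; apply: functional_extensionality_dep => v; apply: fI.
by have := congr1 (fun g : {dffun forall v, F v} => g v) E; rewrite !ffunE.
Qed.

(** Permutations of a subset of a finite type extend to the type by fixing the
    complement, so a finite action takes values in a finite group. *)
Lemma separate_by_finite_action (G : groupType) (P : Type)
    (F : {multiplicative G -> Sym P}) (g : G) :
  finitely_many P -> F g <> 1 ->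
  exists (Q : finGroupType) (f : {multiplicative G -> Q}),
    (forall q, exists x, f x = q) /\ f g <> 1.
Proof.
move=> [E [i iI]] Fg.
pose ext (s : Sym P) (x : E) : E :=
  if pselect (exists p, i p = x) is left ex then i (app s (projT1 (cid ex))) else x.
have extE s p : ext s (i p) = i (app s p).
  rewrite /ext; case: pselect => [ex|[]]; last by exists p.
  by case: cid => q /= /iI ->.
have extN s x : ~ (exists p, i p = x) -> ext s x = x.
  by rewrite /ext; case: pselect.
have extM s t x : ext (s * t) x = ext s (ext t x).
  case: (pselect (exists p, i p = x)) => [[p <-]|n]; first by rewrite !extE.
  by rewrite !extN // (extN t).
have ext1 x : ext 1 x = x.
  by case: (pselect (exists p, i p = x)) => [[p <-]|n]; rewrite ?extE ?extN.
have extI s : injective (ext s).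
  by apply: (@can_inj _ _ _ (ext s^-1)) => x; rewrite -extM mulVg ext1.
pose f0 (x : G) : {perm E} := perm (extI (F x^-1)).
have f0M : {morph f0 : x y / x * y}.
  move=> x y; apply/perm.permP => e; rewrite permM !permE invgM gmulfM; exact: extM.
have f01 : f0 1 = 1 by apply: (mulgI (f0 1)); rewrite -f0M !mulg1.
have sI : group_set (finset.finset (fun p : {perm E} => `[< exists x, f0 x = p >])).
  apply/group_setP; split; first by rewrite !inE; exists 1.
  move=> p q; rewrite !inE => -[x <-] [y <-].
  by exists (x * y).
pose I := fingroup.Group sI.
have inI x : f0 x \in I by rewrite !inE; exists x.
pose f1 (x : G) : subg_of I := subg I (f0 x).
have f1M : {morph f1 : x y / x * y}.
  move=> x y; apply: val_inj; rewrite /= /f1.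
  by rewrite !subgK // f0M.
exists (subg_of I), (to_morphism f1M); split.
  move=> q; have := valP q; rewrite !inE => -[x xE].
  by exists x; apply: val_inj; rewrite /= /f1 subgK.
move=> f1g; apply: Fg; apply: app_inj => p.
have : f0 g = 1 by have := congr1 val f1g; rewrite /= /f1 subgK.
move=> /(congr1 (fun s : {perm E} => s (i (app (F g) p)))).
rewrite permE perm1 extE => /iI.
by rewrite morphV appK app1.
Qed.

Lemma action_morphism (A : groupType) (P : Type) (act : A -> P -> P) :
  (forall x, act 1 x = x) -> (forall a b x, act (a * b) x = act a (act b x)) ->
  exists F : {multiplicative A -> Sym P}, forall a x, app (F a) x = act a x.
Proof.
move=> act1 actM.
have actI a : bijective (act a).
  by exists (act a^-1) => x; rewrite -actM ?mulVg ?mulgV act1.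
have /choice [f fE] : forall a, exists s : Sym P, app s = act a.
  by move=> a; exact: bijection_sym.
have fM : {morph f : a b / a * b}.
  by move=> a b; apply: app_inj => x; rewrite appM !fE actM.
by exists (to_morphism fM) => a x; rewrite -fE.
Qed.

(** * Homomorphisms out of a fundamental group *)

Section Pi1Maps.
Variables (Y : graph_of_groups) (T : {set edge Y}) (M : groupType).
Variables (phi : forall v : vertex Y, {multiplicative vgroup v -> M})
  (tau : edge Y -> M).
Hypothesis phi_edge : forall e c,
  tau e * phi (etgt e) (att_tgt e c) = phi (esrc e) (att_src e c) * tau e.
Hypothesis tau_tree : forall e, e \in T -> tau e = 1.

Definition eval_letter (l : letter Y) : M :=
  match l with
  | inl (existT v a) => phi v a
  | inr (e, b) => if b then tau e else (tau e)^-1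
  end.

Definition eval_word (w : word Y) : M :=
  foldr (fun l m => eval_letter l * m) 1 w.

Lemma eval_word_cat w1 w2 : eval_word (w1 ++ w2) = eval_word w1 * eval_word w2.
Proof. by elim: w1 => [|l w1 IH] /=; rewrite ?mul1g // IH mulgA. Qed.

Lemma eval_word_rel w1 w2 : word_rel T w1 w2 -> eval_word w1 = eval_word w2.
Proof.
elim=> {w1 w2} //=.
- by move=> w1 w2 w3 _ -> _ ->.
- by move=> w1 w1' w2 w2' _ E1 _ E2; rewrite !eval_word_cat E1 E2.
- by move=> v; rewrite mulg1 morph1.
- by move=> v a b; rewrite !mulg1 gmulfM.
- by move=> e [] /=; rewrite mulg1 ?mulgV ?mulVg.
- by move=> e c; rewrite !mulg1 mulgA phi_edge mulgK.
- by move=> e /tau_tree ->; rewrite mulg1.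
Qed.

(** The universal property of the fundamental group. *)
Lemma pi1_lift : exists F : {multiplicative pi1 T -> M},
  (forall v (a : vgroup v), F (pi1_class T [:: vletter a]) = phi v a) /\
  (forall e b, F (pi1_class T [:: eletter e b]) = if b then tau e else (tau e)^-1).
Proof.
pose f (x : pi1 T) := eval_word (repr x).
have fE w : f (pi1_class T w) = eval_word w.
  by apply: eval_word_rel; exact: word_rel_repr.
have fM : {morph f : x y / x * y}.
  move=> x y; rewrite -[x]pi1_class_repr -[y]pi1_class_repr.
  by rewrite [_ * _]pi1_mulE !fE eval_word_cat.
exists (to_morphism fM); split=> [v a|e b]; rewrite [LHS]fE /= mulg1 //.
Qed.

End Pi1Maps.

Lemma edge_adj_sym (V E : finType) (s t : E -> V) (A : {set E}) :
  symmetric (edge_adj s t A).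
Proof.
by move=> u v; apply/existsP/existsP => -[e] /andP[eA] /orP uv; exists e;
  rewrite eA; apply/orP; case: uv; [right|left|right|left].
Qed.

Lemma edge_adj_sub (V E : finType) (s t : E -> V) (A B : {set E}) :
  A \subset B -> subrel (edge_adj s t A) (edge_adj s t B).
Proof.
move=> /fintype.subsetP AB u v /existsP[e /andP[eA uv]]; apply/existsP; exists e.
by rewrite AB.
Qed.

(** Holonomy along a tree is trivial. The edges of the tree are glued one at a
    time: correcting [tau] on the component of one end of the new edge makes the
    relation hold there, and by minimality of the tree this component does not
    contain the other end. *)
Lemma tree_gauge (Y : graph_of_groups) (T : {set edge Y}) (M : groupType)
    (sigma : edge Y -> M) :
  is_spanning_tree T ->
  exists tau : vertex Y -> M,
    forall e, e \in T -> tau (esrc e) = sigma e * tau (etgt e).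
Proof.
move=> [Tconn Tmin].
suff H (s : seq (edge Y)) : uniq s -> {subset s <= T} ->
    exists tau : vertex Y -> M,
    forall e, e \in s -> tau (esrc e) = sigma e * tau (etgt e).
  have [||tau tauP] := H (enum T); first exact: enum_uniq.
    by move=> e; rewrite mem_enum.
  by exists tau => e eT; apply: tauP; rewrite mem_enum.
elim: s => [|e s IHs] /=; first by exists (fun=> 1).
move=> /andP[es us] sT.
have [|tau tauP] := IHs us; first by move=> x xs; apply: sT; rewrite inE xs orbT.
pose A : {set edge Y} := finset.finset (fun x => x \in s).
pose r := edge_adj (@esrc Y) (@etgt Y) A.
have r_sym : connect_sym r by apply: sym_connect_sym; exact: edge_adj_sym.
have ATe : A \subset (T :\ e).
  apply/fintype.subsetP => x; rewrite !inE => xs; rewrite sT ?inE ?xs ?orbT // andbT.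
  by apply: contraNneq es => <-.
have sep : ~~ connect r (etgt e) (esrc e).
  apply/negP => c; apply: (Tmin e); first by apply: sT; rewrite inE eqxx.
  have cA : subrel (connect r) (connect (edge_adj (@esrc Y) (@etgt Y) ((T :\ e)))).
    by apply: connect_sub => x y rxy; apply: connect1; apply: edge_adj_sub ATe _ _ rxy.
  move=> u v; have := Tconn u v; apply: connect_sub => {u v} u v.
  move=> /existsP[e' /andP[e'T uv]].
  have [e'e|ne] := eqVneq e' e; last first.
    apply: connect1; apply/existsP; exists e'; rewrite uv andbT.
    by rewrite finset.in_setD1 ne.
  move: uv; rewrite e'e => /orP[/eqP[<- <-]|/eqP[<- <-]]; apply: cA => //.
  by rewrite r_sym.
pose rho := (tau (etgt e))^-1 * (sigma e)^-1 * tau (esrc e).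
exists (fun x => if connect r (etgt e) x then tau x * rho else tau x) => e'.
rewrite inE => /orP[/eqP ->|e's].
  by rewrite (negbTE sep) connect0 /rho !mulgA mulgK mulgV mul1g.
have adj : r (esrc e') (etgt e').
  by apply/existsP; exists e'; rewrite finset.inE e's eqxx.
rewrite (same_connect_r r_sym (connect1 adj)).
by case: ifP => _; rewrite tauP // ?mulgA.
Qed.

(** * Actions of an edge group and their intertwiners *)

Section Intertwiners.
Variables (A : groupType) (P : Type).

(** A free action of the quotient by [K], without forming the quotient. *)
Definition constant_stabilizer (alpha : A -> Sym P) (K : set A) :=
  forall c x, app (alpha c) x = x <-> K c.

Lemma constant_stabilizer_eq (alpha : {multiplicative A -> Sym P}) K c d x :
  constant_stabilizer alpha K -> app (alpha c) x = app (alpha d) x <-> K (d^-1 * c).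
Proof.
move=> iso; rewrite -(iso _ x) gmulfM morphV appM.
split=> [->|E]; first by rewrite appK.
by rewrite -{2}E appKV.
Qed.

Lemma constant_stabilizer_trans (alpha beta : {multiplicative A -> Sym P}) K c d x y :
  constant_stabilizer alpha K -> constant_stabilizer beta K ->
  app (alpha c) x = app (alpha d) x -> app (beta c) y = app (beta d) y.
Proof. by move=> ia ib /(constant_stabilizer_eq _ _ _ ia) /(constant_stabilizer_eq _ _ y ib). Qed.

(** The points are coordinatized by an orbit representative [rho] and a position
    [kappa] in the orbit; the position is only determined modulo the
    stabilizer. *)
Lemma orbit_section (alpha : {multiplicative A -> Sym P}) (x0 : P) :
  exists (rho : P -> P) (kappa : P -> A),
    (forall c x, rho (app (alpha c) x) = rho x) /\
    (forall x, x = app (alpha (kappa x)) (rho x)).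
Proof.
pose O x := [set y | exists c, app (alpha c) x = y].
pose rho x : P := @xget {classic P} x0 (O x).
have OE c x : O (app (alpha c) x) = O x.
  apply/seteqP; split=> _ [d <-].
    by exists (d * c); rewrite gmulfM.
  by exists (d / c); rewrite gmulfM morphV appM appK.
have /choice [kappa kP] : forall x, exists c, x = app (alpha c) (rho x).
  move=> x; have [c cE] : O x (rho x) by apply: (@xgetPex {classic P} x0); exists x, 1; rewrite morph1.
  by exists c^-1; rewrite -cE morphV appK.
by exists rho, kappa; split=> // c x; rewrite /rho OE.
Qed.

(** Two actions of [A] on [P] with the same stabilizers may have different
    numbers of orbits. On [P * P], with [A] acting on the first factor, they
    become isomorphic without any counting: one coordinate of a pair is read as
    (position, orbit) for [beta] and the other as (position, orbit) for [alpha],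
    and exchanging the two positions converts one action into the other. *)
Lemma square_intertwiner (alpha beta : {multiplicative A -> Sym P}) K (x0 : P) :
  constant_stabilizer alpha K -> constant_stabilizer beta K ->
  exists s : Sym (P * P), forall c x y,
    app s (app (beta c) x, y) =
    (app (alpha c) (app s (x, y)).1, (app s (x, y)).2).
Proof.
move=> ia ib.
have [ra [ka [raI kaP]]] := orbit_section alpha x0.
have [rb [kb [rbI kbP]]] := orbit_section beta x0.
pose swap (a b : A -> Sym P) (r r' : P -> P) (k k' : P -> A) (p : P * P) :=
  (app (a (k' p.1)) (r p.2), app (b (k p.2)) (r' p.1)).
have swapK (a b : {multiplicative A -> Sym P}) r r' k k' :
    constant_stabilizer a K -> constant_stabilizer b K ->
    (forall c x, r (app (a c) x) = r x) -> (forall x, x = app (a (k x)) (r x)) ->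
    (forall c x, r' (app (b c) x) = r' x) -> (forall x, x = app (b (k' x)) (r' x)) ->
    cancel (swap a b r r' k k') (swap b a r' r k' k).
  move=> isa isb rI kP rI' kP' [x y]; rewrite /swap /=.
  have rr z : r (r z) = r z by rewrite -{1}(rI (k z)) -kP.
  have rr' z : r' (r' z) = r' z by rewrite -{1}(rI' (k' z)) -kP'.
  rewrite rI rI' rr rr'; congr (_, _).
    rewrite [RHS]kP'; apply: (constant_stabilizer_trans _ isa isb (x := r y)).
    by rewrite -{2}(rr y) -(rI (k' x) (r y)) -kP.
  rewrite [RHS]kP; apply: (constant_stabilizer_trans _ isb isa (x := r' x)).
  by rewrite -{2}(rr' x) -(rI' (k y) (r' x)) -kP'.
have [|s sE] := bijection_sym (f := swap alpha beta ra rb ka kb).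
  by exists (swap beta alpha rb ra kb ka); apply: swapK.
exists s => c x y; rewrite sE /swap /= rbI; congr (_, _).
rewrite -appM -gmulfM; apply: (constant_stabilizer_trans _ ib ia (x := rb x)).
by rewrite gmulfM appM -kbP -(rbI c) -kbP.
Qed.

(** The centralizer of an action with constant stabilizers is transitive on
    points, and the element that takes [z] to [y] can be chosen to move only
    their orbits: it sends the point at position [c] of one orbit to the point
    at position [c] of the other. This is well defined because stabilizers
    agree. *)
Lemma orbit_swap (alpha : {multiplicative A -> Sym P}) K (z y : P) :
  constant_stabilizer alpha K ->
  exists s : Sym P, [/\ forall c, s * alpha c = alpha c * s, app s z = y &
    forall x, (forall c, app (alpha c) z <> x) -> (forall c, app (alpha c) y <> x) ->
      app s x = x].
Proof.
move=> ia.
pose swap (z y x : P) : P :=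
  if pselect (exists c, app (alpha c) z = x) is left e
  then app (alpha (projT1 (cid e))) y
  else if pselect (exists c, app (alpha c) y = x) is left e
  then app (alpha (projT1 (cid e))) z else x.
have swapl z' y' c : swap z' y' (app (alpha c) z') = app (alpha c) y'.
  rewrite /swap; case: pselect => [e|[]]; last by exists c.
  by case: cid => d /= dE; apply: (constant_stabilizer_trans _ ia ia dE).
have swapr z' y' c : (forall d, app (alpha d) z' <> app (alpha c) y') ->
    swap z' y' (app (alpha c) y') = app (alpha c) z'.
  move=> n; rewrite /swap; case: pselect => [[d dE]|_]; first by case: (n d).
  case: pselect => [e|[]]; last by exists c.
  by case: cid => d /= dE; apply: (constant_stabilizer_trans _ ia ia dE).
have swapn z' y' x : (forall c, app (alpha c) z' <> x) ->
    (forall c, app (alpha c) y' <> x) -> swap z' y' x = x.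
  move=> n1 n2; rewrite /swap; case: pselect => [[c cE]|_]; first by case: (n1 c).
  by case: pselect => // -[c cE]; case: (n2 c).
have cases (z' y' x : P) : [\/ exists c, app (alpha c) z' = x,
    (forall d, app (alpha d) z' <> x) /\ (exists c, app (alpha c) y' = x) |
    (forall c, app (alpha c) z' <> x) /\ (forall c, app (alpha c) y' <> x)].
  have [e|/forallNP n] := pselect (exists c, app (alpha c) z' = x); first by constructor 1.
  have [e|/forallNP n'] := pselect (exists c, app (alpha c) y' = x); first by constructor 2.
  by constructor 3.
have swapK z' y' : cancel (swap z' y') (swap y' z').
  move=> x; case: (cases z' y' x) => [[c <-]|[n [c cE]]|[n n']].
  - rewrite swapl.
    case: (pselect (exists d, app (alpha d) z' = app (alpha c) y')) => [[d dE]|n].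
    + by rewrite swapl.
    + by rewrite swapl.
  - rewrite -cE in n *; rewrite swapr // swapr // => d dE.
    by apply: (n (c / d * c)); rewrite gmulfM appM -dE gmulfM morphV !appM appK.
  - by rewrite !swapn.
have [|s sE] := bijection_sym (f := swap z y).
  by exists (swap y z); apply: swapK.
exists s; split; last 2 first.
- by rewrite sE; have := swapl z y 1; rewrite morph1.
- by move=> x; rewrite sE; exact: swapn.
move=> c; apply: app_inj => x; rewrite !appM sE.
have tr z' : (exists d, app (alpha d) z' = app (alpha c) x) ->
    exists d, app (alpha d) z' = x.
  by move=> [d dE]; exists (c^-1 * d); rewrite gmulfM appM dE morphV appK.
case: (cases z y x) => [[d <-]|[n [d dE]]|[n n']].
- by rewrite swapl -!appM -!gmulfM swapl.
- rewrite -dE in n *; rewrite swapr // -!appM -!gmulfM swapr // => d' d'E.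
  case: (tr z) => [|d'' d''E]; last by case: (n _ (etrans d''E (esym dE))).
  by exists d'; rewrite d'E gmulfM appM dE.
- rewrite !swapn // => d dE.
    by case: (tr z) => [|d' d'E]; [exists d | case: (n _ d'E)].
  by case: (tr y) => [|d' d'E]; [exists d | case: (n' _ d'E)].
Qed.

(** An intertwiner is corrected at one prescribed point after another by a
    swap of two orbits, which does not disturb the points already treated since
    the prescriptions concern distinct orbits. *)
Lemma extend_intertwiner (alpha beta : {multiplicative A -> Sym P}) K
    (s0 : Sym P) (Q : nat -> Prop) (X Z : nat -> P) (m : nat) :
  constant_stabilizer alpha K -> (forall c, s0 * beta c = alpha c * s0) ->
  (forall i j, i <> j -> Q i -> Q j ->
     forall c, app (beta c) (X i) <> X j /\ app (alpha c) (Z i) <> Z j) ->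
  exists s : Sym P, (forall c, s * beta c = alpha c * s) /\
    forall i, (i < m)%N -> Q i -> app s (X i) = Z i.
Proof.
move=> ia s0P dis; elim: m => [|m [s [sP sX]]]; first by exists s0.
have [Qm|nQ] := pselect (Q m); last first.
  exists s; split=> // i; rewrite ltnS leq_eqVlt => /orP[/eqP ->|] //.
  exact: sX.
have [t [tC tz tfix]] := orbit_swap (app s (X m)) (Z m) ia.
exists (t * s); split=> [c|i]; first by rewrite -mulgA sP mulgA tC mulgA.
rewrite ltnS leq_eqVlt => /orP[/eqP -> //|im] Qi; rewrite appM sX //.
have ni : i <> m by move=> E; rewrite E ltnn in im.
apply: tfix => c; last by have [] := dis _ _ (nesym ni) Qm Qi c.
rewrite -sX // -appM -sP appM => E.
by case: (dis _ _ (nesym ni) Qm Qi c) => + _; apply; exact: app_injective E.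
Qed.

End Intertwiners.

(** * Cosets *)

Section Cosets.
Variables (A : groupType) (K : set A).
Hypothesis sgK : is_subgroup K.

Definition cosets := {C : set A | exists g, C = translate g K}.

Lemma coset_eq (C D : cosets) : sval C = sval D -> C = D.
Proof. by case: C D => [C pC] [D pD]; exact: eq_exist. Qed.

Lemma coset_act_proof (a : A) (C : cosets) :
  exists g, translate a (sval C) = translate g K.
Proof. by case: C => [_ /= [g ->]]; exists (a * g); rewrite translateM. Qed.

Definition coset_act (a : A) (C : cosets) : cosets :=
  exist _ (translate a (sval C)) (coset_act_proof a C).

Lemma coset_act1 C : coset_act 1 C = C.
Proof. by apply: coset_eq; rewrite /= translate1. Qed.

Lemma coset_actM a b C : coset_act (a * b) C = coset_act a (coset_act b C).
Proof. by apply: coset_eq; rewrite /= translateM. Qed.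

Lemma translate_sub (h : A) : translate h K = K <-> K h.
Proof.
split=> [E|Kh]; first by rewrite -E /translate /= mulVg; exact: sub1.
apply/seteqP; split=> x; rewrite /translate /= => Kx; last first.
  by apply: subM => //; exact: subV.
by rewrite -(mulVKg h x); exact: subM.
Qed.

Lemma translate_eq g h : translate g K = translate h K <-> K (g^-1 * h).
Proof.
rewrite -translate_sub translateM; split=> [<-|E].
  by rewrite -translateM mulVg translate1.
by rewrite -{1}E -translateM mulgV translate1.
Qed.

Definition coset0 : cosets := exist _ K (ex_intro _ 1 (esym (translate1 K))).

Lemma coset_act_fix a C : (forall x y : A, x * y = y * x) ->
  coset_act a C = C <-> K a.
Proof.
move=> cA; split=> [/(congr1 sval)|Ka].
  case: C => [_ /= [g ->]]; rewrite -translateM translate_eq.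
  by rewrite invgM -mulgA cA -mulgA mulgV mulg1 => /(subV sgK); rewrite invgK.
apply: coset_eq; case: C => [_ /= [g ->]]; rewrite -translateM translate_eq.
rewrite invgM -mulgA cA -mulgA mulgV mulg1; exact: subV.
Qed.

End Cosets.

Lemma finitely_many_cosets (A : groupType) (K : set A) n :
  isomorphic_to_Z2 A -> is_subgroup K -> (0 < n)%N -> (forall x, K (x ^+ n)) ->
  finitely_many (cosets K).
Proof.
move=> [f [f_bij fD]] sgK n0 Kn.
exists {set 'I_n * 'I_n}, (fun C =>
  finset.finset (fun p : 'I_n * 'I_n => `[< sval C (f (Posz p.1, Posz p.2)) >])).
have cosetE g h : translate g K h -> translate g K = translate h K.
  by move=> gh; apply/translate_eq.
have rep (C : cosets K) : exists p : 'I_n * 'I_n, sval C (f (Posz p.1, Posz p.2)).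
  case: C => [_ /= [g ->]]; have [[a b] ->] := lattice_surj f_bij g.
  have mod_lt (z : int) : (absz (z %% n)%Z < n)%N by have := ltz_pmod z (d := n); lia.
  exists (Ordinal (mod_lt a), Ordinal (mod_lt b)); rewrite /translate /=.
  have modE (z : int) : Posz (absz (z %% n)%Z) = (z %% n)%Z by lia.
  rewrite (_ : _^-1 * _ = f (- (a %/ n)%Z, - (b %/ n)%Z)%R ^+ n) //.
  apply: (mulgI (f (a, b))); rewrite mulVKg latticeX // -fD; congr f.
  rewrite /= !modE; congr (_, _) => /=.
    by rewrite [X in (_ = X + _)%R](divz_eq a n); ring.
  by rewrite [X in (_ = X + _)%R](divz_eq b n); ring.
move=> C D E; apply: coset_eq; have [p Cp] := rep C.
have Dp : sval D (f (Posz p.1, Posz p.2)).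
  have : p \in finset.finset (fun p : 'I_n * 'I_n => `[< sval C (f (Posz p.1, Posz p.2)) >]).
    by rewrite !inE.
  by rewrite E !inE.
case: C D {E} Cp Dp => [_ /= [g ->]] [_ /= [h ->]] Cp Dp.
by rewrite (cosetE _ _ Cp) (cosetE _ _ Dp).
Qed.

(** * Routes in a graph of groups *)

Definition vsubset (Y : graph_of_groups) := forall v : vertex Y, set (vgroup v).

Section Darts.
Variable Y : graph_of_groups.

(** An edge with a direction of travel, [true] for the chosen orientation. It
    lets the two attaching maps of an edge be treated as one map [iatt]. *)
Definition dart : Type := (edge Y * bool)%type.

Definition flip (d : dart) : dart := (d.1, ~~ d.2).
Definition ini (d : dart) : vertex Y := if d.2 then esrc d.1 else etgt d.1.
Definition ter (d : dart) : vertex Y := ini (flip d).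

Definition iatt (d : dart) : {multiplicative egroup d.1 -> vgroup (ini d)} :=
  match d as d' return {multiplicative egroup d'.1 -> vgroup (ini d')} with
  | (e, true) => att_src e
  | (e, false) => att_tgt e
  end.

Lemma iatt_inj d : injective (iatt d).
Proof. by case: d => e []; [exact: att_src_inj | exact: att_tgt_inj]. Qed.

Definition step := {d : dart & vgroup (ter d)}.

Definition step_word (x : step) : word Y :=
  [:: eletter (tag x).1 (tag x).2; vletter (tagged x)].

Definition route_word (s : seq step) : word Y := flatten (map step_word s).

Fixpoint is_route (u : vertex Y) (s : seq step) (w : vertex Y) : Prop :=
  if s is x :: s' then ini (tag x) = u /\ is_route (ter (tag x)) s' w else u = w.

(** [y] crosses back the dart of [x], and the vertex element in between lies in
    the edge group times [K]: modulo [K] the route can be shortened. *)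
Definition backtrack (K : vsubset Y) (x y : step) :=
  tag y = flip (tag x) /\
  exists c, K (ter (tag x)) (iatt (flip (tag x)) c * tagged x).

Definition reduced (K : vsubset Y) (s : seq step) :=
  forall i x y, onth s i = Some x -> onth s i.+1 = Some y -> ~ backtrack K x y.

End Darts.

Section ProductAction.
Variable Y : graph_of_groups.
Hypothesis vcomm : forall (v : vertex Y) (a b : vgroup v), a * b = b * a.
Variable K : vsubset Y.
Arguments K : clear implicits.
Hypothesis sgK : forall v, is_subgroup (K v).
Hypothesis K_edge : forall e c, K _ (att_src e c) <-> K _ (att_tgt e c).

Let M := forall v, cosets (K v).

Lemma product_action v : exists F : {multiplicative vgroup v -> Sym M},
  constant_stabilizer F (K v).
Proof.
pose act (a : vgroup v) (m : M) : M := dfwith m (coset_act a (m v)).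
have [||F FE] := @action_morphism _ M act.
- move=> m; apply: functional_extensionality_dep => u; rewrite /act coset_act1.
  by case: dfwithP.
- move=> a b m; apply: functional_extensionality_dep => u; rewrite /act.
  rewrite dfwith_in coset_actM; case: (eqVneq v u) => [<-|ne].
    by rewrite !dfwith_in.
  by rewrite !dfwith_out.
exists F => a m; rewrite FE /act -(coset_act_fix (sgK v) a (m v)); last exact: vcomm.
split=> [E|->].
  by have := congr1 (fun m : M => m v) E; rewrite dfwith_in.
by apply: functional_extensionality_dep => u; case: dfwithP.
Qed.

Variables (I : Type) (m0 : M).
Let P := ((M * M) * I)%type.

(** The product over all vertices of the coset sets carries actions of all the
    vertex groups on the same set. Its square makes the two actions
    of each edge group conjugate, and the factor [I] provides as many disjoint
    invariant copies as needed. *)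
Lemma layered_representation :
  exists (phi : forall v, {multiplicative vgroup v -> Sym P})
         (sigma : edge Y -> Sym P),
    [/\ forall v, constant_stabilizer (phi v) (K v),
        forall v a p, (app (phi v a) p).2 = p.2 &
        forall e c, sigma e * phi (etgt e) (att_tgt e c) =
                    phi (esrc e) (att_src e c) * sigma e].
Proof.
pose phi0 v := projT1 (cid (product_action v)).
have iso0 v : constant_stabilizer (phi0 v) (K v) := projT2 (cid (product_action v)).
have lift v : exists F : {multiplicative vgroup v -> Sym P}, forall a p,
    app (F a) p = (app (phi0 v a) p.1.1, p.1.2, p.2).
  apply: action_morphism => [[[x y] i]|a b [[x y] i]] /=.
    by rewrite morph1.
  by rewrite gmulfM.
pose phi v := projT1 (cid (lift v)).
have phiE v a p : app (phi v a) p = (app (phi0 v a) p.1.1, p.1.2, p.2).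
  exact: (projT2 (cid (lift v))).
have /choice [sigma sigmaP] : forall e, exists s : Sym P, forall c,
    s * phi (etgt e) (att_tgt e c) = phi (esrc e) (att_src e c) * s.
  move=> e.
  have [||s sP] := @square_intertwiner _ _ (phi0 (esrc e) \o att_src e)
      (phi0 (etgt e) \o att_tgt e) (fun c => K _ (att_src e c)) m0.
  - by move=> c m; exact: iso0.
  - by move=> c m; rewrite K_edge; exact: iso0.
  have [|t tE] := bijection_sym (f := fun p : P => (app s p.1, p.2)).
    by exists (fun p : P => (app s^-1 p.1, p.2)) => -[p i] /=; rewrite ?appK ?appKV.
  exists t => c; apply: app_inj => -[[x y] i].
  by rewrite !appM !phiE tE /= sP.
exists phi, sigma; split=> // [v a [[x y] i]|v a p]; last by rewrite phiE.
rewrite phiE /= -(iso0 v a x); split=> [[]//|->//].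
Qed.

End ProductAction.

Lemma pi1_classM (Y : graph_of_groups) (T : {set edge Y}) (w1 w2 : word Y) :
  pi1_class T (w1 ++ w2) = pi1_class T w1 * pi1_class T w2.
Proof. exact/esym/pi1_mulE. Qed.

Lemma pi1_class_nil (Y : graph_of_groups) (T : {set edge Y}) :
  pi1_class T [::] = 1.
Proof. by []. Qed.

Section RouteValue.
Variables (Y : graph_of_groups) (T : {set edge Y}).
Hypothesis treeT : is_spanning_tree T.
Variables (B : groupType) (phi : forall v : vertex Y, {multiplicative vgroup v -> B})
  (sigma : edge Y -> B).
Hypothesis sigma_edge : forall e c,
  sigma e * phi (etgt e) (att_tgt e c) = phi (esrc e) (att_src e c) * sigma e.

Definition dart_value (d : dart Y) : B :=
  if d.2 then sigma d.1 else (sigma d.1)^-1.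

Definition route_value (s : seq (step Y)) : B :=
  foldr (fun x m => dart_value (tag x) * phi (ter (tag x)) (tagged x) * m) 1 s.

(** A representation of the groupoid of routes need not be trivial along the
    tree; after a change of gauge it is, and factors through the fundamental
    group. A closed route then acts by a conjugate of its value. *)
Lemma route_representation : exists (F : {multiplicative pi1 T -> B}) (tau : vertex Y -> B),
  forall v (a : vgroup v) s, is_route v s v ->
    F (pi1_class T (vletter a :: route_word s)) = (phi v a * route_value s) ^ tau v.
Proof.
have [tau tauP] := tree_gauge sigma treeT.
pose phi' v := projT1 (cid (conj_morphism (phi v) (tau v))).
have phi'E v a : phi' v a = phi v a ^ tau v.
  exact: (projT2 (cid (conj_morphism (phi v) (tau v)))).
pose sigma' e := (tau (esrc e))^-1 * sigma e * tau (etgt e).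
have [||F [Fv Fe]] := @pi1_lift Y T B phi' sigma'.
- move=> e c; rewrite !phi'E /sigma' !conjgE !mulgA mulgK mulgK.
  by rewrite -(mulgA _ (sigma e) (phi _ _)) sigma_edge !mulgA.
- by move=> e eT; rewrite /sigma' tauP // invgM mulgVK mulVg.
exists F, tau.
have Fd (d : dart Y) : F (pi1_class T [:: eletter d.1 d.2]) =
    (tau (ini d))^-1 * dart_value d * tau (ter d).
  rewrite Fe; case: d => e [] //=.
  by rewrite /sigma' !invgM invgK mulgA.
have Fs s u w : is_route u s w ->
    F (pi1_class T (route_word s)) = (tau u)^-1 * route_value s * tau w.
  elim: s u => [|x s IHs] u /=.
    by move=> ->; rewrite pi1_class_nil morph1 mulg1 mulVg.
  case=> <- /IHs E.
  rewrite /route_word /= -/(route_word s).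
  rewrite -[eletter _ _ :: _]/([:: eletter (tag x).1 (tag x).2] ++
    ([:: vletter (tagged x)] ++ route_word s)).
  rewrite !pi1_classM !gmulfM Fd Fv phi'E E conjgE !mulgA.
  by rewrite mulgK mulgK.
move=> v a s rs.
rewrite -[vletter _ :: _]/([:: vletter a] ++ route_word s) pi1_classM gmulfM Fv.
by rewrite phi'E (Fs _ _ _ rs) !conjgE !mulgA mulgK.
Qed.

End RouteValue.

Section RouteAction.
Variables (Y : graph_of_groups) (T : {set edge Y}).
Hypothesis treeT : is_spanning_tree T.
Hypothesis vcomm : forall (v : vertex Y) (a b : vgroup v), a * b = b * a.
Variable K : vsubset Y.
Arguments K : clear implicits.
Hypothesis sgK : forall v, is_subgroup (K v).
Hypothesis K_edge : forall e c, K _ (att_src e c) <-> K _ (att_tgt e c).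

(** Layer [i] contains a point [y i] where the route stands after crossing its
    first [i] darts. The intertwiners can be prescribed so that each dart takes
    the point after it to the point before it: two prescriptions for the same
    edge could only interfere inside one layer, between consecutive steps, and
    there they lie in distinct orbits of the edge group exactly because the
    route is reduced. The whole route then moves the last layer to the first.
    With [K] trivial this gives the normal form theorem, with [K] of finite
    index a finite permutation representation. *)
Lemma reduced_route_acts v (a : vgroup v) (s : seq (step Y)) :
  is_route v s v -> reduced K s -> (s = [::] -> ~ K v a) ->
  exists (P : Type) (F : {multiplicative pi1 T -> Sym P}),
    F (pi1_class T (vletter a :: route_word s)) <> 1 /\
    ((forall v, finitely_many (cosets (K v))) -> finitely_many P).
Proof.
move=> rs red_s nKa.
pose k := size s.
pose m0 v := coset0 (K v).
have [phi [sigma0 [iso layer sigma0P]]] :=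
  layered_representation vcomm sgK K_edge 'I_k.+1 m0.
pose P := (((forall v, cosets (K v)) * (forall v, cosets (K v))) * 'I_k.+1)%type.
rewrite -/P in phi sigma0 iso layer sigma0P.
(* [X i] and [Z i] are the points that the intertwiner of the edge crossed at
   step [i] has to match; which of them is the later one depends on the
   direction. *)
pose y i : P := ((m0, m0), inord i).
pose X i : P := if onth s i is Some x then
    if (tag x).2 then app (phi _ (tagged x)) (y i.+1) else y i else y 0%N.
pose Z i : P := if onth s i is Some x then
    if (tag x).2 then y i else app (phi _ (tagged x)) (y i.+1) else y 0%N.
(* Within one layer the two prescribed points lie in distinct orbits. *)
have cross i e b (a1 : vgroup (ter (e, b))) (a2 : vgroup (ter (e, ~~ b))) c :
    onth s i = Some (existT _ (e, b) a1) ->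
    onth s i.+1 = Some (existT _ (e, ~~ b) a2) ->
    app (phi _ (iatt (flip (e, b)) c)) (app (phi _ a1) (y i.+1)) <> y i.+1.
  move=> ix ix'; rewrite -appM -gmulfM => /(iso _ _ (y i.+1)) Kc.
  by apply: (red_s _ _ _ ix ix'); split=> //; exists c.
have cross' i e b (a1 : vgroup (ter (e, b))) (a2 : vgroup (ter (e, ~~ b))) c :
    onth s i = Some (existT _ (e, b) a1) ->
    onth s i.+1 = Some (existT _ (e, ~~ b) a2) ->
    app (phi _ (iatt (flip (e, b)) c)) (y i.+1) <> app (phi _ a1) (y i.+1).
  move=> ix ix' E; apply: (cross _ _ _ _ _ c^-1 ix ix').
  by rewrite -E !morphV appK.
have /choice [sigma sigmaP] : forall e, exists t : Sym P,
    (forall c, t * phi (etgt e) (att_tgt e c) = phi (esrc e) (att_src e c) * t) /\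
    forall i x, onth s i = Some x -> (tag x).1 = e -> app t (X i) = Z i.
  move=> e.
  pose Q i := exists x, onth s i = Some x /\ (tag x).1 = e.
  have Qk i : Q i -> (i < k)%N.
    by case=> x [E _]; rewrite ltnNge; apply/negP => /(onth_default (s := s)); rewrite E.
  have [|||t [tP tX]] := @extend_intertwiner _ _
    (phi (esrc e) \o att_src e) (phi (etgt e) \o att_tgt e)
    (fun c => K _ (att_src e c)) (sigma0 e) Q X Z k.
  - by move=> c p; exact: iso.
  - by move=> c; exact: sigma0P.
  - move=> i j ij Qi Qj c; have ik := Qk i Qi; have jk := Qk j Qj.
    case: Qi Qj => [[[e1 b1] a1] [ix /= e1e]] [[[e2 b2] a2] [jx /= e2e]].
    rewrite {}e1e in a1 ix; rewrite {}e2e in a2 jx.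
    rewrite /X /Z ix jx /=.
    have val_y t (tk : (t <= k)%N) : val (y t).2 = t by rewrite /= inordK.
    have [yi yi1 yj yj1] := And4 (val_y _ (ltnW ik)) (val_y _ ik) (val_y _ (ltnW jk)) (val_y _ jk).
    case: b1 a1 ix => a1 ix; case: b2 a2 jx => a2 jx /=; split=> E;
      have := congr1 (fun p : P => val p.2) E;
      rewrite ?layer ?yi ?yi1 ?yj ?yj1 => ijE; try (by case: ij; case: ijE);
      first [subst j | subst i].
    + exact: cross ix jx E.
    + exact: cross' jx ix E.
    + exact: cross' jx ix E.
    + exact: cross ix jx E.
  exists t; split=> [c|i x ix xe]; first exact: tP.
  have Qi : Q i by exists x.
  by apply: tX => //; exact: Qk.
have sigma_edge e c := (sigmaP e).1 c.
have [F [tau FE]] := route_representation treeT sigma_edge.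
exists P, F; split; last first.
  move=> fK; apply: finitely_many_prod; last exact: finitely_many_fin.
  by apply: finitely_many_prod; exact: finitely_many_forall.
rewrite FE // => /eqP; rewrite conjg_eq1 => /eqP E.
have step_y i x : onth s i = Some x ->
    app (dart_value sigma (tag x)) (app (phi _ (tagged x)) (y i.+1)) = y i.
  move=> ix; have := (sigmaP _).2 _ _ ix erefl.
  rewrite /X /Z ix /dart_value; case: (tag x).2 => // <-.
  by rewrite appK.
(* The value of the route from position [j] on takes its last point to [y j]. *)
have value_y s' j : (forall i x, onth s' i = Some x ->
      app (dart_value sigma (tag x)) (app (phi _ (tagged x)) (y (j + i).+1)) = y (j + i)%N) ->
    app (route_value phi sigma s') (y (j + size s')%N) = y j.
  elim: s' j => [|x s' IHs] j H; first by rewrite addn0.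
  rewrite /= !appM addnS -addSn IHs; last first.
    by move=> i x' ix'; have := H i.+1 x' ix'; rewrite addnS -addSn.
  by have := H 0%N x erefl; rewrite addn0.
have := congr1 (fun t => app t (y k)) E.
rewrite appM app1 -[k]add0n value_y // => {}E.
have [s0|sn0] := eqVneq k 0%N.
  by apply: nKa; [exact: size0nil | apply/(iso v a (y 0%N)); rewrite E s0].
have := congr1 (fun p : P => val p.2) E; rewrite layer /= !inordK // => k0.
by case/eqP: sn0; exact: esym k0.
Qed.

End RouteAction.

(** * Reduced forms *)

Section ReducedForm.
Variables (Y : graph_of_groups) (T : {set edge Y}).
Hypothesis treeT : is_spanning_tree T.

Definition trivial_subsets : vsubset Y := fun v => [set 1].

Lemma pi1_dart (d : dart Y) c :
  pi1_class T [:: eletter d.1 d.2] * pi1_class T [:: vletter (iatt (flip d) c)] =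
  pi1_class T [:: vletter (iatt d c)] * pi1_class T [:: eletter d.1 d.2].
Proof.
have tV e b : pi1_class T [:: eletter e b] * pi1_class T [:: eletter e (~~ b)] = 1.
  by rewrite -pi1_classM; apply/pi1_classP; exact: word_rel_stable.
have E e (c' : egroup e) : pi1_class T [:: eletter e true] *
    pi1_class T [:: vletter (att_tgt e c')] =
    pi1_class T [:: vletter (att_src e c')] * pi1_class T [:: eletter e true].
  have <- : pi1_class T ([:: eletter e true; vletter (att_tgt e c')] ++
      [:: eletter e false]) = pi1_class T [:: vletter (att_src e c')].
    by apply/pi1_classP; exact: word_rel_edge.
  rewrite pi1_classM -mulgA (tV e false) mulg1 -pi1_classM //.
case: d c => e [] c /=; first exact: E.
have fE : pi1_class T [:: eletter e false] = (pi1_class T [:: eletter e true])^-1.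
  by apply: (mulgI (pi1_class T [:: eletter e true])); rewrite (tV e true) mulgV.
apply: (mulgI (pi1_class T [:: eletter e true])).
by rewrite fE mulVKg mulgA E mulgK.
Qed.

Lemma pi1_tree_letter e b : e \in T -> pi1_class T [:: eletter e b] = 1.
Proof.
move=> eT; have E : pi1_class T [:: eletter e true] = 1.
  by apply/pi1_classP; exact: word_rel_tree.
case: b => //; rewrite -[LHS]mul1g -{1}E -pi1_classM.
by apply/pi1_classP; exact: (word_rel_stable _ e true).
Qed.

(** The route may end at a vertex [w] different from its start; the tree letters
    being trivial, its class is still an element of the fundamental group. *)
Definition has_reduced_form (u w : vertex Y) (g : pi1 T) :=
  exists (a : vgroup u) (s : seq (step Y)), [/\ is_route u s w,
    reduced trivial_subsets s & g = pi1_class T (vletter a :: route_word s)].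

Lemma reduced_cons (K : vsubset Y) x s :
  (forall y s', s = y :: s' -> ~ backtrack K x y) -> reduced K s ->
  reduced K (x :: s).
Proof.
move=> nb rs [|i] y z /=; last exact: rs.
case: s nb {rs} => // z' s nb [<-] [<-]; exact: nb.
Qed.

Lemma reduced_behead (K : vsubset Y) x s : reduced K (x :: s) -> reduced K s.
Proof. by move=> rs i; exact: (rs i.+1). Qed.

Lemma pi1_vletterM (v : vertex Y) (a b : vgroup v) w :
  pi1_class T [:: vletter a] * pi1_class T (vletter b :: w) =
  pi1_class T (vletter (a * b) :: w).
Proof.
rewrite -pi1_classM; apply/pi1_classP.
apply: (@word_rel_cat _ _ [:: vletter a; vletter b] [:: vletter (a * b)]).
  exact: word_rel_mul.
exact: word_rel_refl.
Qed.

Lemma pi1_vletter1 (v : vertex Y) w :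
  pi1_class T (vletter (1 : vgroup v) :: w) = pi1_class T w.
Proof.
apply/pi1_classP; apply: (@word_rel_cat _ _ [:: vletter 1] [::]).
  exact: word_rel_one.
exact: word_rel_refl.
Qed.

Lemma reduced_form_vletter u w g (b : vgroup u) : has_reduced_form u w g ->
  has_reduced_form u w (pi1_class T [:: vletter b] * g).
Proof.
move=> [a [s [rs red ->]]]; exists (b * a), s; split=> //.
by rewrite pi1_vletterM.
Qed.

(** The new dart either extends the reduced route or cancels with its first
    dart, and in the second case the edge relation moves the vertex element
    across. *)
Lemma reduced_form_dart (d : dart Y) w g : has_reduced_form (ter d) w g ->
  has_reduced_form (ini d) w (pi1_class T [:: eletter d.1 d.2] * g).
Proof.
move=> [a [s [rs red ->]]].
pose x : step Y := existT _ d a.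
have [[y [s' [sE [yE [c cE]]]]]|nb] :=
    pselect (exists y s', s = y :: s' /\ backtrack trivial_subsets x y); last first.
  exists 1, (x :: s); split=> //.
    by apply: reduced_cons => // y s' sE bt; apply: nb; exists y, s'.
  by rewrite pi1_vletter1 -pi1_classM.
rewrite {}sE in rs red *; case: rs => _ rs.
have {c cE} [c cE] : exists c : egroup d.1, a = iatt (flip d) c.
  exists c^-1; have ca : iatt (flip d) c * a = 1 := cE.
  by rewrite morphV -[LHS](mulKg (iatt (flip d) c)) ca mulg1.
have {}yE : tag y = flip d := yE.
clear x; rewrite {a}cE.
case: y yE rs red => d' a' /= yE; rewrite {}yE in a' * => rs red.
rewrite -[vletter _ :: _]/([:: vletter (iatt (flip d) c)] ++
  ([:: eletter (flip d).1 (flip d).2] ++ (vletter a' :: route_word s'))).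
rewrite !pi1_classM !mulgA pi1_dart -(mulgA _ (pi1_class T [:: eletter d.1 d.2])).
have -> : pi1_class T [:: eletter d.1 d.2] *
    pi1_class T [:: eletter (flip d).1 (flip d).2] = 1.
  by rewrite -pi1_classM; apply/pi1_classP; exact: word_rel_stable.
rewrite mulg1.
case: d c a' rs red => e [] c a' /= rs red.
  exists (att_src e c * a'), s'; split=> //; first exact: reduced_behead red.
  by rewrite pi1_vletterM.
exists (att_tgt e c * a'), s'; split=> //; first exact: reduced_behead red.
by rewrite pi1_vletterM.
Qed.

(** Walking along the tree changes the start of a route but not its class. *)
Lemma reduced_form_start u v w g : has_reduced_form u w g ->
  has_reduced_form v w g.
Proof.
move=> rg; have /connectP[p] := treeT.1 v u.
elim: p v => [|v' p IHp] v /=; first by move=> _ <-.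
case/andP=> /existsP[e /andP[eT uv]] pp up.
have rv' := IHp v' pp up.
case/orP: uv => /eqP [sE tE].
  have := @reduced_form_dart (e, true) w g; rewrite /ter /ini /= sE tE.
  by rewrite pi1_tree_letter // mul1g; apply.
have := @reduced_form_dart (e, false) w g; rewrite /ter /ini /= sE tE.
by rewrite pi1_tree_letter // mul1g; apply.
Qed.

Lemma reduced_form v (g : pi1 T) : has_reduced_form v v g.
Proof.
rewrite -(pi1_class_repr g); elim: (repr g) => [|l w IHw].
  exists 1, [::]; split=> //; by rewrite pi1_vletter1.
rewrite -[l :: w]/([:: l] ++ w) pi1_classM.
case: l => [[u b]|[e b]].
  apply: (reduced_form_start (u := u)); apply: reduced_form_vletter.
  exact: reduced_form_start IHw.
apply: (reduced_form_start (u := ini (e, b))); apply: reduced_form_dart.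
exact: reduced_form_start IHw.
Qed.

(** Britton's lemma. *)
Lemma reduced_route_neq1 v (a : vgroup v) s :
  (forall (v : vertex Y) (a b : vgroup v), a * b = b * a) ->
  is_route v s v -> reduced trivial_subsets s -> (s = [::] -> a <> 1) ->
  pi1_class T (vletter a :: route_word s) <> 1.
Proof.
move=> vcomm rs red na.
have sg1 v' : is_subgroup (@trivial_subsets v').
  by split=> // x y -> ->; rewrite /trivial_subsets /= divg1.
have [|P [F [nF _]] E] := reduced_route_acts treeT vcomm sg1 _ rs red na.
- move=> e c; rewrite /trivial_subsets /=.
  by rewrite -(morph1 (att_src e)) -(morph1 (att_tgt e)); split=> [/att_src_inj|/att_tgt_inj] ->.
by apply: nF; rewrite E morph1.
Qed.

End ReducedForm.

(** * Finite index and the Bass-Serre tree *)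

Definition core (G : groupType) (H : set G) : set G := [set g | forall x, H (g ^ x)].

Section FiniteIndex.
Variables (G : groupType) (H : set G).
Hypothesis sgH : is_subgroup H.

Lemma core_subgroup : is_subgroup (core H).
Proof.
split=> [x|x y Hx Hy z]; first by rewrite conj1g; exact: sub1.
by rewrite conjMg conjVg; apply: subF.
Qed.

Lemma core_conj g x : core H g -> core H (g ^ x).
Proof. by move=> Hg y; rewrite -conjgM. Qed.

Lemma core_sub g : core H g -> H g.
Proof. by move=> /(_ 1); rewrite conjg1. Qed.

(** A power of [g] fixes each of the finitely many cosets, by the pigeonhole
    principle, with an exponent at most their number; the factorial serves all
    cosets and all [g] at once. *)
Lemma finite_index_power : finite_index H ->
  exists2 m, (0 < m)%N & forall g, core H (g ^+ m).
Proof.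
move=> /finite_seqP[s sE]; exists (size s)`!; first exact: fact_gt0.
move=> g x; pose C (i : nat) := translate (g ^+ i * x) H.
have Cs i : C i \in s.
  by have : [set` s] (C i) by rewrite -sE; exists (g ^+ i * x).
have Cidx i : (index (C i) s < size s)%N by rewrite index_mem.
have [inj|] := pselect (injective (fun i : 'I_(size s).+1 => Ordinal (Cidx i))).
  by have := leq_card _ inj; rewrite !card_ord ltnn.
move=> /existsNP[i /existsNP[j /not_implyP[]]].
wlog ij : i j / (i < j)%N.
  move=> W E ne; case: (ltngtP i j) => [ij|ji|/val_inj //]; first exact: W ij E ne.
  by apply: (W j i ji (esym E)) => /esym.
move=> /(congr1 val) /= E _.
have {}E : C i = C j by rewrite -(nth_index set0 (Cs i)) E nth_index.
have : H (g ^+ (j - i) ^ x).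
  have := (translate_eq sgH _ _).1 E; rewrite invgM.
  by rewrite -{1}(subnKC (ltnW ij)) expgnDr -!mulgA mulKg.
have /dvdnP[q ->] : (j - i)%N %| (size s)`!.
  by apply: dvdn_fact; rewrite subn_gt0 ij /=; apply: leq_trans (leq_subr _ _) _; rewrite -ltnS; exact: ltn_ord.
by move=> Hx; rewrite mulnC expgnA conjXg; exact: subX.
Qed.

End FiniteIndex.

Section SplittingFacts.
Variables (G : groupType) (S : splitting G).
Hypothesis tubS : is_tubular (gog S).
Notation Y := (gog S).
Notation T := (stree S).

Lemma tubular_comm (v : vertex Y) (a b : vgroup v) : a * b = b * a.
Proof. by have [f [f_bij fD]] := tubS.1 v; exact: lattice_comm f_bij fD a b. Qed.

Lemma spi1_inj : injective (spi1 S). Proof. exact: bij_inj (spi1_bij S). Qed.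

Lemma in_vgroup_inj (v : vertex Y) : injective (@in_vgroup G S v).
Proof.
move=> a b /spi1_inj E; apply: divg1_eq; apply: contrapT => ab1.
have := @reduced_route_neq1 Y T (streeP S) v (a / b) [::] tubular_comm.
apply=> //.
rewrite /route_word /=.
have <- : pi1_class T [:: vletter a; vletter b^-1] = pi1_class T [:: vletter (a / b)].
  exact/pi1_classP/word_rel_mul.
rewrite -[[:: _; _]]/([:: vletter a] ++ [:: vletter b^-1]) pi1_classM E -pi1_classM.
by apply/pi1_classP; exact: (word_rel_inv_letter _ (vletter b)).
Qed.

(** The end of the base edge along [d] is the translate of the base vertex by
    [carrier d]. *)
Definition carrier (d : dart Y) : G := if d.2 then 1 else stable_letter S d.1.

Lemma base_edge_proof (e : edge Y) : exists g, eimage S e = translate g (eimage S e).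
Proof. by exists 1; rewrite translate1. Qed.

Definition base_edge (e : edge Y) : bs_edge S :=
  exist _ (e, eimage S e) (base_edge_proof e).

Definition bs_end (b : bool) (y : bs_edge S) : bs_vertex S :=
  if b then bs_src y else bs_tgt y.

Lemma bs_end_act b g y : bs_end b (bs_eact g y) = bs_vact g (bs_end b y).
Proof. by case: b; [exact: bs_src_act | exact: bs_tgt_act]. Qed.

Lemma bs_end_base (d : dart Y) :
  sval (bs_end d.2 (base_edge d.1)) = (ini d, translate (carrier d) (vimage S (ini d))).
Proof.
case: d => e [] /=.
  by rewrite -{1}(translate1 (eimage S e)) src_cosetE.
by rewrite -{1}(translate1 (eimage S e)) tgt_cosetE mul1g.
Qed.

(** The defining relation of the stable letter, for both ends at once. *)
Lemma carrier_edge (d : dart Y) (c : egroup d.1) :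
  in_vgroup S (iatt d c) ^ (carrier d)^-1 = in_vgroup S (att_src d.1 c).
Proof.
case: d c => e [] c; rewrite /carrier /=; first by rewrite invg1 conjg1.
by rewrite conjgE invgK mulgA -stable_letterP mulgK.
Qed.

Lemma vimage_subgroup v : is_subgroup (vimage S v).
Proof.
split; first by exists 1 => //; rewrite in_vgroup1.
move=> _ _ [a _ <-] [b _ <-]; exists (a / b) => //.
by rewrite in_vgroupM in_vgroupV.
Qed.

Lemma eimage_subgroup e : is_subgroup (eimage S e).
Proof.
split; first exact: eimage1.
move=> _ _ [a _ <-] [b _ <-]; exists (a / b) => //.
by rewrite gmulfM morphV in_vgroupM in_vgroupV.
Qed.

Lemma translate_fix (V : set G) (g x : G) : is_subgroup V ->
  translate x (translate g V) = translate g V <-> V (x ^ g).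
Proof.
move=> sgV; rewrite -translateM translate_eq // invgM -!mulgA.
split=> [Vx|Vx].
  by apply: (subVE sgV); rewrite conjgE !invgM invgK -mulgA.
by have := subV sgV Vx; rewrite conjgE !invgM invgK -mulgA.
Qed.

Lemma fix_end (d : dart Y) (x : G) :
  bs_vact x (bs_end d.2 (base_edge d.1)) = bs_end d.2 (base_edge d.1) <->
  vimage S (ini d) (x ^ carrier d).
Proof.
rewrite -translate_fix; last exact: vimage_subgroup.
split=> [/(congr1 sval)|E].
  by rewrite /= bs_end_base => -[].
by apply: bs_vertex_eq; rewrite /= bs_end_base E.
Qed.

Lemma fix_base_edge e (x : G) :
  bs_eact x (base_edge e) = base_edge e <-> eimage S e x.
Proof.
rewrite -(translate_sub (eimage_subgroup e)).
split=> [/(congr1 sval)|E]; first by case.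
by apply: bs_edge_eq; rewrite /= E.
Qed.

Lemma in_vgroupX (v : vertex Y) (a : vgroup v) n :
  in_vgroup S (a ^+ n) = in_vgroup S a ^+ n.
Proof.
by elim: n => [|n IHn]; rewrite ?in_vgroup1 // !expgS in_vgroupM IHn.
Qed.

(** Maximal cyclic subgroups of a rank two lattice contain the roots of their
    elements. The edge [base_edge d.1] is a translate by [H] of one of the
    representatives of the induced splitting, and conjugating by this element
    carries the statement for the representative to [d]. *)
Lemma primitive_roots (H : set G) (Y' : graph_of_groups) (d : dart Y)
    (a : vgroup (ini d)) j :
  is_subgroup H -> quotient_gog (bass_serre S) H Y' -> is_tubular Y' ->
  is_primitive Y' -> core H (in_vgroup S a) -> (0 < j)%N ->
  range (iatt d) (a ^+ j) -> range (iatt d) a.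
Proof.
move=> sgH Q tubY' primY' Ha j0 [c _ cE].
pose y := base_edge d.1.
have [e' [[h Hh hy] _]] := qedgeP Q y.
have [q [v' [Hq [att [[att_inj maxatt] [qE attE]]]]]] : exists (q : G) (v' : vertex Y'),
    H q /\ exists att : {multiplicative egroup e' -> vgroup v'},
    (injective att /\ is_maximal_cyclic (range att)) /\
    bs_end d.2 (qedge Q e') = bs_vact q (qvert Q v') /\
    (forall c, qvgroup Q v' (att c) = qegroup Q e' c ^ q).
  case: (d.2).
    exists (qsrc Q e'), (esrc e'); split; first exact: qsrc_in.
    exists (att_src e'); split; last by split; [exact: (qsrcP Q) | exact: (qatt_src Q)].
    by split; [exact: att_src_inj | case: (primY' e')].
  exists (qtgt Q e'), (etgt e'); split; first exact: qtgt_in.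
  exists (att_tgt e'); split; last by split; [exact: (qtgtP Q) | exact: (qatt_tgt Q)].
  by split; [exact: att_tgt_inj | case: (primY' e')].
pose x := in_vgroup S a ^ (carrier d)^-1.
have Hx : H x by apply: core_sub; exact: core_conj.
have HJ g k : H g -> H k -> H (g ^ k).
  by move=> Hg Hk; rewrite conjgE; apply: subM => //; [exact: subV | exact: subM].
have yE : bs_end d.2 y = bs_vact (h * q) (qvert Q v').
  by rewrite -hy /= bs_end_act qE bs_vactM.
have fixJ g k z : bs_vact g (bs_vact k z) = bs_vact k z -> bs_vact (g ^ k) z = z.
  move=> E; rewrite conjgE !bs_vactM E -bs_vactM mulVg; exact: bs_vact1.
have fixEJ g k z : bs_eact g (bs_eact k z) = bs_eact k z -> bs_eact (g ^ k) z = z.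
  move=> E; rewrite conjgE !bs_eactM E -bs_eactM mulVg; exact: bs_eact1.
have [p _ pE] : range (qvgroup Q v') (x ^ (h * q)).
  rewrite qvgroupP; split; first by apply: HJ => //; exact: subM.
  apply: fixJ; rewrite -yE; apply/fix_end.
  by rewrite conjgKV; exists a.
have xjE : x ^+ j = in_vgroup S (att_src d.1 c).
  by rewrite /x -conjXg -in_vgroupX -cE carrier_edge.
have [c' _ c'E] : range (qegroup Q e') (x ^+ j ^ h).
  rewrite qegroupP; split; first by apply: HJ => //; exact: subX.
  apply: fixEJ; rewrite [bs_eact h _]hy; apply/fix_base_edge.
  by rewrite xjE; exists c.
have pj : p ^+ j = att c'.
  apply: (@qvgroup_inj _ _ _ _ Q); rewrite morphX pE attE c'E.
  by rewrite conjgM !conjXg.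
have [f [f_bij fD]] := tubY'.1 v'.
have [c2 _ c2E] : range att p.
  by apply: (maximal_cyclic_isolated f_bij fD maxatt j0); rewrite pj; exists c'.
have xh : x ^ h = qegroup Q e' c2.
  by apply: (conjg_inj q); rewrite -conjgM -pE -c2E attE.
have [_ xfix] : [set h | H h /\ eact h (qedge Q e') = qedge Q e'] (x ^ h).
  by rewrite -qegroupP xh; exists c2.
have [c3 _ c3E] : eimage S d.1 x.
  have hVy : bs_eact h^-1 y = qedge Q e'.
    by rewrite -hy -[bs_eact _ _](bs_eactM h^-1 h) mulVg bs_eact1.
  have xE : x = h * (x ^ h * h^-1) by rewrite -{1}(conjgK h x) conjgE invgK.
  apply/fix_base_edge; move: (x ^ h) xfix xE => z zfix ->.
  by rewrite !bs_eactM -/y hVy [bs_eact z _]zfix.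
exists c3 => //; apply: in_vgroup_inj.
by apply: (conjg_inj (carrier d)^-1); rewrite carrier_edge c3E.
Qed.

End SplittingFacts.

(** * From virtual primitivity to residual finiteness *)

Lemma common_multiple (k : nat) (Q : nat -> nat -> Prop) :
  (forall i, exists2 n0, (0 < n0)%N & forall n, (0 < n)%N -> n0 %| n -> Q i n) ->
  exists2 n, (0 < n)%N & forall i, (i < k)%N -> Q i n.
Proof.
move=> H; suff [n n0 nP] : exists2 n0, (0 < n0)%N &
    forall n i, (0 < n)%N -> n0 %| n -> (i < k)%N -> Q i n.
  by exists n => // i; apply: nP.
elim: k => [|k [n n0 nP]]; first by exists 1%N.
have [m m0 mP] := H k; exists (n * m)%N; first by rewrite muln_gt0 n0.
move=> l i l0 nml; rewrite ltnS leq_eqVlt => /orP[/eqP ->|ik].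
  by apply: mP => //; apply: dvdn_trans nml; exact: dvdn_mull.
by apply: nP => //; apply: dvdn_trans nml; exact: dvdn_mulr.
Qed.

Section Powers.
Variables (G : groupType) (S : splitting G) (N : set G).
Hypothesis tubS : is_tubular (gog S).
Hypotheses (sgN : is_subgroup N) (N_conj : forall g x, N g -> N (g ^ x)).
Notation Y := (gog S).
Notation T := (stree S).

(** The congruence subgroups by which the vertex groups are divided. Taking
    [n]-th powers of the elements of [N] rather than of all elements is what
    makes them match along the edges. *)
Definition vertex_powers n : vsubset Y :=
  fun v => [set b : vgroup v | exists2 a, N (in_vgroup S a) & b = a ^+ n].

Lemma vertex_powers_subgroup n (v : vertex Y) : is_subgroup (@vertex_powers n v).
Proof.
split; first by exists 1; rewrite ?expg1n // in_vgroup1; exact: sub1.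
move=> _ _ [a Na ->] [b Nb ->]; exists (a / b).
  by rewrite in_vgroupM in_vgroupV; exact: subF.
by rewrite expgnFl //; exact: tubular_comm.
Qed.

Hypothesis N_roots : forall (d : dart Y) (a : vgroup (ini d)) j,
  N (in_vgroup S a) -> (0 < j)%N -> range (iatt d) (a ^+ j) -> range (iatt d) a.

(** An [n]-th power of an element of [N] that lies in the edge group is the [n]-th
    power of an element of the edge group, because the edge group contains the
    roots. The right hand side does not depend on the end of the edge. *)
Lemma vertex_powers_dart n (d : dart Y) (c : egroup d.1) : (0 < n)%N ->
  @vertex_powers n (ini d) (iatt d c) <->
  exists2 c', N (in_vgroup S (att_src d.1 c')) & c = c' ^+ n.
Proof.
move=> n0; split=> [[a Na aE]|[c' Nc' ->]]; last first.
  exists (iatt d c'); last by rewrite morphX.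
  by rewrite -(conjgKV (carrier d) (in_vgroup S _)) carrier_edge; exact: N_conj.
have [c' _ c'E] : range (iatt d) a by apply: N_roots n0 _ => //; rewrite -aE; exists c.
exists c'; first by rewrite -carrier_edge c'E; exact: N_conj.
by apply: iatt_inj; rewrite morphX c'E.
Qed.

Lemma vertex_powers_edge n e c : (0 < n)%N ->
  @vertex_powers n _ (att_src e c) <-> @vertex_powers n _ (att_tgt e c).
Proof.
move=> n0; rewrite -[att_src e]/(iatt (e, true)) -[att_tgt e]/(iatt (e, false)).
by rewrite (vertex_powers_dart (d := (e, true))) // (vertex_powers_dart (d := (e, false))).
Qed.

(** Reducedness means that certain vertex elements avoid certain edge groups,
    which persists modulo suitable powers since edge groups are separable. *)
Lemma reduced_mod_powers s : reduced (@trivial_subsets Y) s ->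
  forall i, exists2 n0, (0 < n0)%N & forall n, (0 < n)%N -> n0 %| n ->
    forall x y, onth s i = Some x -> onth s i.+1 = Some y ->
    ~ backtrack (vertex_powers n) x y.
Proof.
move=> red i.
case ix : (onth s i) => [x|]; last by exists 1%N.
case iy : (onth s i.+1) => [y|]; last by exists 1%N.
have nb := red i x y ix iy.
have [yx|yx] := pselect (tag y = flip (tag x)); last first.
  by exists 1%N => // n _ _ x' y' [<-] [<-] [].
have [f [f_bij fD]] := tubS.1 (ter (tag x)).
have Cx : ~ range (iatt (flip (tag x))) (tagged x).
  case=> c _ cE; apply: nb; split=> //; exists c^-1.
  by rewrite morphV cE; exact: mulVg.
have cycC := infinite_cyclic_range (iatt (flip (tag x))) (tubS.2 _).
have [n0 n00 n0P] := cyclic_separable f_bij fD cycC Cx.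
exists n0 => // n npos dvd x' y' [<-] [<-] [_ [c [a _ aE]]].
apply: (n0P n (iatt (flip (tag x)) c^-1) a npos dvd); first by exists c^-1.
by rewrite morphV -aE mulKg.
Qed.

End Powers.

(** A nontrivial element is a reduced route; modulo the [n]-th powers of the
    elements of the normal core, for a suitable [n], the route remains reduced,
    and the vertex groups become finite. *)
Lemma virtually_primitive_residually_finite (G : groupType) (S : splitting G) :
  is_tubular (gog S) -> virtually_primitive S -> residually_finite G.
Proof.
move=> tubS [H [Y' [sgH fiH [Q] tubY' primY']]] g g1.
pose Y := gog S; pose T := stree S.
pose N := core H.
have sgN : is_subgroup N by exact: core_subgroup.
have N_conj x y : N x -> N (x ^ y) by exact: core_conj.
have N_roots (d : dart Y) (a : vgroup (ini d)) j : N (in_vgroup S a) ->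
    (0 < j)%N -> range (iatt d) (a ^+ j) -> range (iatt d) a.
  by move=> Na; exact: primitive_roots Q tubY' primY' Na.
have [spi1V [spi1K spi1VK]] := bijective_morphism_inverse (spi1_bij S).
have [v0 _] : exists v0 : vertex Y, v0 \in vertex Y.
  by apply/card_gt0P; exact: vertex_inhabited.
have [a [s [rs red gE]]] := reduced_form (streeP S) v0 (spi1V g).
have g1' : spi1V g <> 1 by move=> E; apply: g1; rewrite -(spi1VK g) E morph1.
have [k0 k00 k0P] : exists2 k0, (0 < k0)%N & forall n, (0 < n)%N -> k0 %| n ->
    s = [::] -> ~ @vertex_powers _ S N n v0 a.
  have [f [f_bij fD]] := tubS.1 v0.
  have [a1|a1] := pselect (a = 1).
    exists 1%N => // n _ _ s0 _; apply: g1'; rewrite gE s0 a1.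
    exact: pi1_vletter1.
  have na : ~ powers 1 a by case=> i []; rewrite expg1n ?invg1.
  have cyc1 : is_cyclic (powers (1 : vgroup v0)) by exists 1.
  have [n0 n00 n0P] := cyclic_separable f_bij fD cyc1 na.
  exists n0 => // n npos dvd _ [b _ bE].
  by apply: (n0P n 1 b npos dvd); [exists 0%N; left | rewrite mul1g].
pose bad i n := forall x y, onth s i = Some x -> onth s i.+1 = Some y ->
  ~ backtrack (vertex_powers (S := S) N n) x y.
(* Index 0 is the condition on the vertex element of a route without darts. *)
have [|n n0 nP] := @common_multiple (size s).+1 (fun i n =>
    if i is i'.+1 then bad i' n else s = [::] -> ~ @vertex_powers _ S N n v0 a).
  by case=> [|i]; [exists k0 | exact: reduced_mod_powers].
have vE e c := vertex_powers_edge N_conj N_roots (e := e) c n0.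
have [||P [F [F1 finP]]] := @reduced_route_acts Y T (streeP S)
    (@tubular_comm _ _ tubS) (vertex_powers (S := S) N n)
    (vertex_powers_subgroup tubS sgN n) vE v0 a s rs.
- move=> i x y ix iy.
  have ik : (i < size s)%N.
    by rewrite ltnNge; apply/negP => /(onth_default (s := s)); rewrite ix.
  exact: (nP i.+1) ix iy.
- exact: (nP 0%N).
apply: (@separate_by_finite_action G P (F \o spi1V) g); last by rewrite /= gE.
apply: finP => v; have [m m0 mP] := finite_index_power sgH fiH.
apply: (@finitely_many_cosets _ _ (m * n)%N (tubS.1 v)).
- exact: vertex_powers_subgroup.
- by rewrite muln_gt0 m0.
by move=> x; exists (x ^+ m); [rewrite in_vgroupX; exact: mP | rewrite expgnA].
Qed.

(** * A finite quotient that detects roots *)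

Section Commutators.
Variables (G : groupType) (S : splitting G).
Hypothesis tubS : is_tubular (gog S).
Notation Y := (gog S).
Notation T := (stree S).

Definition dart_letter (d : dart Y) : G := spi1 S (pi1_class T [:: eletter d.1 d.2]).

Lemma dart_letterP (d : dart Y) (c : egroup d.1) :
  in_vgroup S (iatt (flip d) c) ^ (dart_letter d)^-1 = in_vgroup S (iatt d c).
Proof.
rewrite conjgE invgK /in_vgroup /dart_letter mulgA -gmulfM pi1_dart gmulfM.
by rewrite mulgK.
Qed.

Lemma dart_letterV (d : dart Y) : dart_letter (flip d) = (dart_letter d)^-1.
Proof.
apply: (mulgI (dart_letter d)); rewrite mulgV /dart_letter -gmulfM -pi1_classM.
rewrite -[RHS](morph1 (spi1 S)); congr (spi1 S _).
by apply/pi1_classP; exact: word_rel_stable.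
Qed.

(** The commutator of [z] with [y], conjugated across [d], is a closed route with
    four darts, which is reduced because [z] and [y] lie outside the edge
    group. *)
Lemma commutator_neq1 (d : dart Y) (z : vgroup (ini d)) (y : vgroup (ter d)) :
  ~ range (iatt d) z -> ~ range (iatt (flip d)) y ->
  in_vgroup S z * in_vgroup S y ^ (dart_letter d)^-1 <>
  in_vgroup S y ^ (dart_letter d)^-1 * in_vgroup S z.
Proof.
move=> nz ny.
set w := in_vgroup S y ^ _ => E.
have {}E : in_vgroup S z * w * (in_vgroup S z)^-1 * w^-1 = 1.
  by rewrite E mulgK mulgV.
move: E; rewrite /w -conjVg -!in_vgroupV !conjgE invgK -!dart_letterV !mulgA.
rewrite /in_vgroup /dart_letter -!gmulfM => E.
have {}E := @spi1_inj _ S _ _ (etrans E (esym (morph1 (spi1 S)))).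
have range_of (d' : dart Y) c (u : vgroup (ini d')) :
    iatt d' c * u = 1 -> range (iatt d') u.
  by move=> cu; exists c^-1 => //; rewrite morphV -(mulKg (iatt d' c) u) cu mulg1.
have rangeV (d' : dart Y) (u : vgroup (ini d')) :
    range (iatt d') u^-1 -> range (iatt d') u.
  by move=> [c _ cE]; exists c^-1 => //; rewrite morphV cE invgK.
case: d z y nz ny w E => e b z y nz ny _ E.
pose st (d : dart Y) (a : vgroup (ter d)) : step Y := existT _ d a.
(* [z^-1] regarded as an element at the end of the reversed dart: the two
   vertices agree by computation only once the direction is known. *)
have [z' [z'V nz']] : exists z' : vgroup (ter (flip (e, b))),
    vletter z' = vletter z^-1 /\ ~ range (iatt (flip (flip (e, b)))) z'.
  case: b z y nz ny E => z y nz _ _; exists z^-1; split=> // r; apply: nz.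
    exact: (rangeV (e, true)) r.
  exact: (rangeV (e, false)) r.
pose s := [:: st (e, b) y; st (flip (e, b)) z'; st (e, b) y^-1; st (flip (e, b)) 1].
have rs : is_route (ini (e, b)) s (ini (e, b)).
  by rewrite /s /=; do !split=> //; rewrite /ter /ini /= ?negbK.
have red : reduced (@trivial_subsets Y) s.
  case=> [|[|[|i]]] x1 x2 /=; last by rewrite onth0n.
  1-3: move=> E1 E2; rewrite -(Some_inj E1) -(Some_inj E2) => -[_ [c cE]].
  - exact: ny (range_of _ _ _ cE).
  - exact: nz' (range_of _ _ _ cE).
  - exact: ny (rangeV _ _ (range_of _ _ _ cE)).
apply: (@reduced_route_neq1 Y T (streeP S) _ z s (tubular_comm tubS) rs red) => //.
have cons2 l1 l2 w : pi1_class T (l1 :: l2 :: w) =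
    pi1_class T [:: l1] * pi1_class T (l2 :: w) by exact: pi1_classM [:: l1] _.
rewrite -E /route_word /= z'V !cons2 pi1_vletter1 pi1_class_nil mulg1.
by rewrite !mulgA.
Qed.

End Commutators.

(** A factor [g] commuting with [w] drops out of the commutator with [w], which
    therefore lies in every normal subgroup that contains [a]. *)
Lemma commutator_modulo_centralizer (G : groupType) (a g w : G) : g * w = w * g ->
  w * (a / g) * (a / g * w)^-1 = a ^ w^-1 / a.
Proof.
move=> gw; have gwV : g^-1 * w^-1 = w^-1 * g^-1 by rewrite -!invgM gw.
rewrite conjgE invgK !invgM invgK !mulgA.
by rewrite -(mulgA _ g^-1 w^-1) gwV !mulgA mulgVK.
Qed.

(** The map [q] to a finite type records that the index is finite. *)
Lemma avoiding_subgroup (G : groupType) (l : seq G) : residually_finite G ->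
  (forall g, g \in l -> g <> 1) ->
  exists (N : set G) (F : finType) (q : G -> F),
    [/\ is_subgroup N, forall g x, N g -> N (g ^ x),
        forall x y, q x = q y -> N (x^-1 * y) & forall g, g \in l -> ~ N g].
Proof.
move=> rfG; elim: l => [|g l IHl] l1.
  by exists setT, bool, (fun=> true).
have [|N [F [q [sgN NJ qN lN]]]] := IHl.
  by move=> x xl; apply: l1; rewrite inE xl orbT.
have [Q [f [_ fg]]] := rfG g (l1 g (mem_head _ _)).
exists [set x | N x /\ f x = 1], (F * Q)%type, (fun x => (q x, f x)); split.
- split=> [|x y [Nx fx] [Ny fy]]; first by split; [exact: sub1 | exact: morph1].
  by split; [exact: subF | rewrite gmulfM morphV fx fy divg1].
- by move=> x y [Nx fx]; split; [exact: NJ | rewrite morphJ fx conj1g].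
- by move=> x y [/qN Nxy E]; split=> //; rewrite gmulfM morphV E mulVg.
move=> x; rewrite inE => /orP[/eqP ->|xl] [Nx fx] //.
exact: (lN _ xl).
Qed.

Lemma finite_index_of_map (G : groupType) (N : set G) (F : finType) (q : G -> F) :
  is_subgroup N -> (forall x y, q x = q y -> N (x^-1 * y)) -> finite_index N.
Proof.
move=> sgN qN.
have /choice [r rP] : forall i : F, exists C : set G,
    forall g, q g = i -> translate g N = C.
  move=> i; have [[g gi]|n] := pselect (exists g, q g = i); last first.
    by exists set0 => g gi; case: n; exists g.
  exists (translate g N) => g' g'i; apply/translate_eq => //.
  by apply: qN; rewrite g'i.
apply: (@sub_finite_set _ _ (r @` [set: F])).
  by move=> _ [g _ <-]; exists (q g) => //; rewrite (rP (q g) g).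
exact: finite_image.
Qed.

(** Let [a] be a root of an element of the edge group of [d]. If [a] is not in
    the edge group, it is one of finitely many elements [z] times an element of
    the edge group. Fix [y] in the group of the adjacent vertex outside the edge
    group. The edge group commutes with the conjugate of [y] across [d], so a
    normal subgroup that contains [a] also contains the commutator of [z] and
    this conjugate, a nontrivial element depending only on [z]. It suffices to
    avoid finitely many nontrivial elements. *)
Lemma rooted_subgroup (G : groupType) (S : splitting G) :
  is_tubular (gog S) -> residually_finite G ->
  exists N : set G, [/\ is_subgroup N, forall g x, N g -> N (g ^ x),
    finite_index N &
    forall (d : dart (gog S)) (a : vgroup (ini d)) j, N (in_vgroup S a) ->
      (0 < j)%N -> range (iatt d) (a ^+ j) -> range (iatt d) a].
Proof.
move=> tubS rfG; pose Y := gog S.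
have cycC (d : dart Y) : is_cyclic (range (iatt d)).
  by apply: infinite_cyclic_range; exact: tubS.2.
have nontriv (d : dart Y) : exists2 c, range (iatt d) c & c <> 1.
  have [f [f_bij fD]] := tubS.2 d.1.
  exists (iatt d (f 1%R)); first by exists (f 1%R).
  rewrite -(morph1 (iatt d)) => E.
  by have := bij_inj f_bij (etrans (iatt_inj E) (esym (zmod_morph0 fD))).
have data (d : dart Y) : exists l : seq G, (forall g, g \in l -> g <> 1) /\
    forall N : set G, is_subgroup N -> (forall g x, N g -> N (g ^ x)) ->
    (forall g, g \in l -> ~ N g) ->
    forall (a : vgroup (ini d)) j, N (in_vgroup S a) -> (0 < j)%N ->
      range (iatt d) (a ^+ j) -> range (iatt d) a.
  have [f [f_bij fD]] := tubS.1 (ini d).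
  have [f' [f'_bij f'D]] := tubS.1 (ini (flip d)).
  have [k [z [zn zP]]] := isolator_cosets f_bij fD (cycC d) (nontriv d).
  have [y yn] := cyclic_proper f'_bij f'D (cycC (flip d)).
  pose w := in_vgroup S y ^ (dart_letter d)^-1.
  pose test i := w * in_vgroup S (z i) * (in_vgroup S (z i) * w)^-1.
  exists [seq test i | i <- iota 0 k]; split.
    move=> g /mapP[i]; rewrite mem_iota => /andP[_ ik] -> /divg1_eq E.
    exact: (commutator_neq1 tubS (zn i ik) yn) (esym E).
  move=> N sgN NJ lN a j Na j0 aj; apply: contrapT => na.
  have [i [_ [ik [c _ <-] aE]]] := zP a j j0 aj na.
  apply: (lN (test i)); first by apply/mapP; exists i => //; rewrite mem_iota.
  have wc : in_vgroup S (iatt d c) * w = w * in_vgroup S (iatt d c).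
    rewrite -dart_letterP /w -!conjMg -!in_vgroupM.
    by rewrite (tubular_comm tubS).
  have zE : in_vgroup S (z i) = in_vgroup S a * (in_vgroup S (iatt d c))^-1.
    by rewrite aE in_vgroupM mulgK.
  have -> : test i = in_vgroup S a ^ w^-1 * (in_vgroup S a)^-1.
    by rewrite /test zE; exact: commutator_modulo_centralizer.
  by apply: subF => //; exact: NJ.
have /choice [l lP] := data.
pose L := flatten [seq l d | d : edge Y * bool].
have [|N [F [q [sgN NJ qN LN]]]] := @avoiding_subgroup G L rfG.
  by move=> g /flattenP[_ /mapP[d _ ->]]; exact: (lP d).1.
exists N; split=> //; first exact: finite_index_of_map qN.
move=> d; apply: (lP d).2 => // g gl; apply: LN; apply/flattenP.
by exists (l d) => //; apply/mapP; exists d => //; rewrite mem_enum.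
Qed.

(** * The splitting induced on a normal subgroup of finite index *)

(** The canonical representatives are the indices that are picked for their own
    class. *)
Lemma class_representatives (J : finType) (X : Type) (R : X -> X -> Prop) (f : J -> X) :
  (forall x, R x x) -> (forall x y, R x y -> R y x) ->
  (forall x y z, R x y -> R y z -> R x z) -> (forall x, exists j, R (f j) x) ->
  exists (V : finType) (q : V -> X), forall x, exists! v, R (q v) x.
Proof.
move=> Rrefl Rsym Rtrans fP.
pose canon j := odflt j [pick i | `[<R (f i) (f j)>]].
have canonR j : R (f (canon j)) (f j).
  by rewrite /canon; case: pickP => [i /asboolP|].
have canonE i j : R (f i) (f j) -> canon i = canon j.
  move=> ij; rewrite /canon.
  rewrite (eq_pick (Q := fun k => `[<R (f k) (f j)>])).
    case: pickP => // nj; have := nj i; by rewrite (asboolT ij).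
  move=> k; apply/asbool_equiv_eq; split=> [ki|kj]; first exact: Rtrans ki ij.
  exact: Rtrans kj (Rsym _ _ ij).
exists {j : J | canon j == j}, (fun v => f (val v)) => x.
have [j jx] := fP x.
have cj : canon (canon j) == canon j by apply/eqP; exact: canonE.
exists (exist _ (canon j) cj); split=> /= [|[i ci] /= ix].
  exact: Rtrans jx.
by apply: val_inj; rewrite /= -(eqP ci); apply: canonE; apply: Rtrans jx (Rsym _ _ ix).
Qed.

Lemma finite_index_representatives (G : groupType) (N : set G) :
  is_subgroup N -> finite_index N ->
  exists (F : finType) (r : F -> G), forall g, exists i, N ((r i)^-1 * g).
Proof.
move=> sgN /finite_seqP[s sE].
have /choice [r rP] : forall i : 'I_(size s), exists g, translate g N = nth set0 s i.
  move=> i; have : [set` s] (nth set0 s i) by rewrite /= mem_nth.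
  by rewrite -sE => -[g _ gE]; exists g.
exists 'I_(size s), r => g.
have gs : translate g N \in s.
  by have : [set` s] (translate g N) by rewrite -sE; exists g.
have gi : (index (translate g N) s < size s)%N by rewrite index_mem.
exists (Ordinal gi); apply/translate_eq => //.
by rewrite rP /= nth_index.
Qed.

Section Orbits.
Variables (G : groupType) (N : set G).
Hypotheses (sgN : is_subgroup N) (N_conj : forall g x, N g -> N (g ^ x)).
Hypothesis fiN : finite_index N.

Lemma orbit_representatives (J : finType) (X : Type) (act : G -> X -> X) (base : J -> X) :
  (forall x, act 1 x = x) -> (forall g h x, act (g * h) x = act g (act h x)) ->
  (forall x, exists j g, x = act g (base j)) ->
  exists (V : finType) (q : V -> X),
    forall x, exists! v, exists2 h, N h & act h (q v) = x.
Proof.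
move=> act1 actM baseP.
have [F [r rP]] := finite_index_representatives sgN fiN.
apply: (@class_representatives (J * F)%type X (fun x y => exists2 h, N h & act h x = y)
  (fun p => act (r p.2) (base p.1))).
- by move=> x; exists 1; [exact: sub1 | exact: act1].
- move=> x _ [h Nh <-]; exists h^-1; first exact: subV.
  by rewrite -actM mulVg act1.
- move=> x _ _ [h Nh <-] [k Nk <-]; exists (k * h); first exact: subM.
  by rewrite actM.
move=> x; have [j [g ->]] := baseP x; have [i ig] := rP g.
exists (j, i), (g * (r i)^-1); last by rewrite -actM mulgVK.
have -> : g * (r i)^-1 = ((r i)^-1 * g) ^ (r i)^-1.
  by rewrite conjgE invgK !mulgA mulgV mul1g.
exact: N_conj.
Qed.

End Orbits.

Section BassSerreConnected.
Variables (G : groupType) (S : splitting G).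
Notation Y := (gog S).
Notation T := (stree S).

Definition base_vertex (v : vertex Y) : bs_vertex S :=
  exist _ (v, vimage S v) (ex_intro _ 1 (esym (translate1 (vimage S v)))).

Lemma bs_vertex_base (x : bs_vertex S) : exists v g, x = bs_vact g (base_vertex v).
Proof. by case: x => [[v C] [g /= E]]; exists v, g; apply: bs_vertex_eq; rewrite /= E. Qed.

Lemma bs_edge_base (y : bs_edge S) : exists e g, y = bs_eact g (base_edge e).
Proof. by case: y => [[e C] [g /= E]]; exists e, g; apply: bs_edge_eq; rewrite /= E. Qed.

Lemma bs_end_baseE (d : dart Y) :
  bs_end d.2 (base_edge d.1) = bs_vact (carrier d) (base_vertex (ini d)).
Proof. by apply: bs_vertex_eq; rewrite bs_end_base. Qed.

Variable R : bs_vertex S -> bs_vertex S -> Prop.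
Hypotheses (R_refl : forall x, R x x) (R_sym : forall x y, R x y -> R y x)
  (R_trans : forall x y z, R x y -> R y z -> R x z).
Hypothesis R_edge : forall y, R (bs_src y) (bs_tgt y).

Lemma bs_dart_linked (d : dart Y) g :
  R (bs_vact g (base_vertex (ini d)))
    (bs_vact (g * dart_letter d) (base_vertex (ter d))).
Proof.
have E e g' : R (bs_vact g' (base_vertex (esrc e)))
    (bs_vact (g' * stable_letter S e) (base_vertex (etgt e))).
  have := R_edge (bs_eact g' (base_edge e)).
  rewrite -[bs_src _]/(bs_end true _) -[bs_tgt _]/(bs_end false _) !bs_end_act.
  rewrite (bs_end_baseE (e, true)) (bs_end_baseE (e, false)) -!bs_vactM.
  by rewrite /carrier /= mulg1.
case: d => e [] /=; first exact: E.
apply: R_sym; rewrite -[(e, false)]/(flip (e, true)) dart_letterV.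
by have := E e (g * (dart_letter (e, true))^-1); rewrite mulgVK.
Qed.

(** Connectedness of the Bass-Serre tree, in the form of an induction principle
    for equivalence relations: translates of base vertices are linked along the
    spanning tree, and multiplying by one more letter of a word moves along one
    edge. *)
Lemma bs_connected x x' : R x x'.
Proof.
have swap u v g : R (bs_vact g (base_vertex u)) (bs_vact g (base_vertex v)).
  have /connectP[p] := (streeP S).1 u v.
  elim: p u => [|w p IHp] u /=; first by move=> _ ->.
  case/andP=> /existsP[e /andP[eT uw]] pp vp; apply: R_trans (IHp w pp vp).
  have t1 b : dart_letter (e, b) = 1.
    by rewrite /dart_letter (pi1_tree_letter b eT) morph1.
  case/orP: uw => /eqP [sE tE].
    by have := bs_dart_linked (e, true) g; rewrite t1 mulg1 /ter /ini /= sE tE.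
  by have := bs_dart_linked (e, false) g; rewrite t1 mulg1 /ter /ini /= sE tE.
have letter (l : letter Y) u g : R (bs_vact g (base_vertex u))
    (bs_vact (g * spi1 S (pi1_class T [:: l])) (base_vertex u)).
  case: l => [[v a]|[e b]].
    apply: R_trans (swap u v g) (R_trans _ (swap v u _)).
    rewrite bs_vactM; have -> : bs_vact (spi1 S (pi1_class T [:: inl (existT _ v a)]))
        (base_vertex v) = base_vertex v => //.
    apply: bs_vertex_eq => /=; congr (_, _).
    by apply: vimage_translate; exists a.
  apply: R_trans (swap u (ini (e, b)) g) (R_trans (bs_dart_linked (e, b) g) (swap _ _ _)).
have word (w : word Y) u g : R (bs_vact g (base_vertex u))
    (bs_vact (g * spi1 S (pi1_class T w)) (base_vertex u)).
  elim: w g => [|l w IHw] g; first by rewrite pi1_class_nil morph1 mulg1.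
  apply: R_trans (letter l u g) _; rewrite -[l :: w]/([:: l] ++ w).
  by rewrite pi1_classM gmulfM mulgA.
have toV u v g : R (base_vertex u) (bs_vact g (base_vertex v)).
  have [g' gK g'K] := spi1_bij S.
  have := word (repr (g' g)) u 1; rewrite pi1_class_repr g'K mul1g bs_vact1 => H.
  exact: R_trans H (swap _ _ _).
have [u [g ->]] := bs_vertex_base x; have [v [h ->]] := bs_vertex_base x'.
exact: R_trans (R_sym (toV u u g)) (toV u v h).
Qed.

End BassSerreConnected.

Section QuotientGraph.
Variables (G : groupType) (S : splitting G) (N : set G).
Hypotheses (sgN : is_subgroup N) (N_conj : forall g x, N g -> N (g ^ x)).
Hypothesis fiN : finite_index N.
Notation Y := (gog S).
Notation X := (bass_serre S).

Lemma stabilizer_subgroup (Z : Type) (act : G -> Z -> Z) (z : Z) :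
  (forall x, act 1 x = x) -> (forall g h x, act (g * h) x = act g (act h x)) ->
  is_subgroup [set h | N h /\ act h z = z].
Proof.
move=> act1 actM; split=> [|x y [Nx xz] [Ny yz]]; first by split; [exact: sub1|].
split; first exact: subF.
by rewrite actM -{1}yz -[act y^-1 _]actM mulVg act1.
Qed.

(** The quotient graph of groups of the action on the Bass-Serre tree: choose
    representatives of the orbits, take their stabilizers, and for each end of
    a chosen edge an element that carries the chosen vertex there. It is
    connected because the tree is. *)
Lemma induced_splitting_exists : exists Y' : graph_of_groups, is_induced_splitting S N Y'.
Proof.
have [V [qv qvP]] := orbit_representatives sgN N_conj fiN (base := base_vertex (S := S))
  (@bs_vact1 G S) (@bs_vactM G S) (@bs_vertex_base G S).
have [E [qe qeP]] := orbit_representatives sgN N_conj fiN (base := base_edge (S := S))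
  (@bs_eact1 G S) (@bs_eactM G S) (@bs_edge_base G S).
pose sv v := subgroup_group (stabilizer_subgroup (qv v) (@bs_vact1 G S) (@bs_vactM G S)).
pose se e := subgroup_group (stabilizer_subgroup (qe e) (@bs_eact1 G S) (@bs_eactM G S)).
pose vg v : groupType := projT1 (cid (sv v)).
pose eg e : groupType := projT1 (cid (se e)).
pose vm v : {multiplicative vg v -> G} := projT1 (cid (projT2 (cid (sv v)))).
pose em e : {multiplicative eg e -> G} := projT1 (cid (projT2 (cid (se e)))).
have vmP v : injective (vm v) /\
    range (vm v) = [set h | N h /\ bs_vact h (qv v) = qv v].
  exact: (projT2 (cid (projT2 (cid (sv v))))).
have emP e : injective (em e) /\
    range (em e) = [set h | N h /\ bs_eact h (qe e) = qe e].
  exact: (projT2 (cid (projT2 (cid (se e))))).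
have carried x : exists p : V * G, N p.2 /\ x = bs_vact p.2 (qv p.1).
  by have [v [[h Nh hx] _]] := qvP x; exists (v, h).
have /choice [ends endsP] : forall p : E * bool, exists r : V * G,
    N r.2 /\ bs_end p.2 (qe p.1) = bs_vact r.2 (qv r.1).
  by move=> p; exact: carried.
have attach p : exists k : {multiplicative eg p.1 -> vg (ends p).1},
    forall c, vm _ (k c) = em _ c ^ (ends p).2.
  have [k kE] := conj_morphism (em p.1) (ends p).2.
  have [|k' k'E] := morphism_factor (h := vm (ends p).1) (k := k) (vmP _).1.
    move=> _ [c _ <-]; rewrite (vmP _).2 kE.
    have [Nc cfix] : [set h | N h /\ bs_eact h (qe p.1) = qe p.1] (em p.1 c).
      by rewrite -(emP _).2; exists c.
    split; first exact: N_conj.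
    have [_ endE] := endsP p; have := bs_end_act p.2 (em p.1 c) (qe p.1).
    rewrite cfix endE => fixE; rewrite conjgE !bs_vactM -fixE -bs_vactM mulVg.
    exact: bs_vact1.
  by exists k' => c; rewrite k'E.
pose att p := projT1 (cid (attach p)).
have attE p c : vm _ (att p c) = em _ c ^ (ends p).2 := projT2 (cid (attach p)) c.
have att_inj p : injective (att p).
  by move=> c d E'; apply: (emP p.1).1; apply: (conjg_inj (ends p).2); rewrite -!attE E'.
pose es e := (ends (e, true)).1; pose et e := (ends (e, false)).1.
have /choice [cls clsP] : forall x, exists v, exists2 h, N h & bs_vact h (qv v) = x.
  by move=> x; have [v [vx _]] := qvP x; exists v.
have clsE x v h : N h -> bs_vact h (qv v) = x -> cls x = v.
  move=> Nh hv; have [w [_ wP]] := qvP x.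
  by rewrite -(wP (cls x) (clsP x)) -(wP v); last by exists h.
have V0 : (0 < #|V|)%N.
  have [v0 _] : exists v : vertex Y, v \in vertex Y.
    by apply/card_gt0P; exact: vertex_inhabited.
  by apply/card_gt0P; exists (cls (base_vertex v0)).
have conn : connected_via es et finset.setT.
  have adj_sym : connect_sym (edge_adj es et finset.setT).
    by apply: sym_connect_sym; exact: edge_adj_sym.
  have cls_qv v : cls (qv v) = v.
    by apply: (clsE _ _ 1); [exact: sub1 | exact: bs_vact1].
  move=> u v; rewrite -(cls_qv u) -(cls_qv v); move: (qv u) (qv v).
  apply: bs_connected => [x|x y|x y z|y]; first exact: connect0.
  - by rewrite adj_sym.
  - exact: connect_trans.
  have [e [[h Nh <-] _]] := qeP y.
  have clsb b : cls (bs_end b (bs_eact h (qe e))) = (ends (e, b)).1.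
    have [Nk kE] := endsP (e, b).
    apply: (clsE _ _ (h * (ends (e, b)).2)); first exact: subM.
    by rewrite bs_end_act bs_vactM -kE.
  rewrite (clsb true) (clsb false); apply: connect1; apply/existsP; exists e.
  by rewrite finset.in_setT eqxx.
pose Y' := @GraphOfGroups V E es et V0 conn vg eg (fun e => att (e, true))
  (fun e => att (e, false)) (fun e => @att_inj (e, true)) (fun e => @att_inj (e, false)).
exists Y'; constructor.
exact: (@QuotientGog G X N Y' qv qe qvP qeP vm em (fun v => (vmP v).1)
  (fun e => (emP e).1) (fun v => (vmP v).2) (fun e => (emP e).2)
  (fun e => (ends (e, true)).2) (fun e => (ends (e, false)).2)
  (fun e => (endsP (e, true)).1) (fun e => (endsP (e, false)).1)
  (fun e => (endsP (e, true)).2) (fun e => (endsP (e, false)).2)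
  (fun e => attE (e, true)) (fun e => attE (e, false))).
Qed.

Variable Y' : graph_of_groups.
Variable Q : quotient_gog X N Y'.
Hypothesis tubS : is_tubular Y.

Definition in_morphism (v : vertex Y) : {multiplicative vgroup v -> G} :=
  to_morphism (@in_vgroupM G S v).

Lemma conj_fix (Z : Type) (act : G -> Z -> Z) (g k : G) (z : Z) :
  (forall x, act 1 x = x) -> (forall g h x, act (g * h) x = act g (act h x)) ->
  act g (act k z) = act k z <-> act (g ^ k) z = z.
Proof.
move=> act1 actM; rewrite conjgE !actM.
by split=> [->|E]; [rewrite -actM mulVg act1 | rewrite -[in RHS]E -[in RHS]actM mulgV act1].
Qed.

(** A stabilizer in [N] is conjugate into a group of the given splitting, where it
    contains all [m]-th powers. *)
Lemma stabilizer_embeds (A B : groupType) (h : {multiplicative A -> G})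
    (k : {multiplicative B -> G}) (g : G) (St : set G) :
  injective h -> injective k -> range k = [set x | N x /\ St x] ->
  (forall x, St x <-> range h (x ^ g)) ->
  exists m (k' : {multiplicative B -> A}), [/\ (0 < m)%N, injective k' &
    forall a, range k' (a ^+ m)].
Proof.
move=> h_inj k_inj kE StE; have [m m0 mP] := finite_index_power sgN fiN.
have [kg kgE] := conj_morphism k g.
have [|k' k'E] := morphism_factor (h := h) (k := kg) h_inj.
  move=> _ [b _ <-]; rewrite kgE; apply/StE.
  by have [] : [set x | N x /\ St x] (k b) by rewrite -kE; exists b.
exists m, k'; split=> // [b c E|a].
  by apply: k_inj; apply: (conjg_inj g); rewrite -!kgE -!k'E E.
have [b _ bE] : range k (h (a ^+ m) ^ g^-1).
  rewrite kE; split.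
    by rewrite morphX; apply: N_conj; apply: core_sub.
  by apply/StE; rewrite conjgKV; exists (a ^+ m).
by exists b => //; apply: h_inj; rewrite k'E kgE bE conjgKV.
Qed.

Lemma induced_tubular : is_tubular Y'.
Proof.
split=> [v'|e'].
  have [v [g vE]] := bs_vertex_base (qvert Q v').
  have [] := @stabilizer_embeds _ _ (in_morphism v) (qvgroup Q v') g
    [set x | bs_vact x (qvert Q v') = qvert Q v'].
  - exact: in_vgroup_inj.
  - exact: qvgroup_inj.
  - exact: qvgroupP.
  - move=> x; change (bs_vact x (qvert Q v') = qvert Q v' <-> vimage S v (x ^ g)).
    rewrite vE (conj_fix _ _ _ (@bs_vact1 G S) (@bs_vactM G S)).
    rewrite -(translate_sub (vimage_subgroup (S := S) v)).
    by split=> [/(congr1 sval) []|E] //; apply: bs_vertex_eq; rewrite /= E.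
  move=> m [k' [m0 k'_inj k'm]].
  exact: lattice_finite_index (tubS.1 v) k'_inj m0 k'm.
have [e [g eE]] := bs_edge_base (qedge Q e').
have [] := @stabilizer_embeds _ _ (in_morphism (esrc e) \o att_src e) (qegroup Q e') g
  [set x | bs_eact x (qedge Q e') = qedge Q e'].
- by apply: inj_comp; [exact: in_vgroup_inj | exact: att_src_inj].
- exact: qegroup_inj.
- exact: qegroupP.
- move=> x; change (bs_eact x (qedge Q e') = qedge Q e' <-> eimage S e (x ^ g)).
  rewrite eE (conj_fix _ _ _ (@bs_eact1 G S) (@bs_eactM G S)).
  exact: fix_base_edge.
move=> m [k' [m0 k'_inj k'm]].
exact: infinite_cyclic_finite_index (tubS.2 e) k'_inj m0 k'm.
Qed.

Hypothesis N_roots : forall (d : dart Y) (a : vgroup (ini d)) j,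
  N (in_vgroup S a) -> (0 < j)%N -> range (iatt d) (a ^+ j) -> range (iatt d) a.

(** Conjugating by [q] and [g] carries the end of the chosen edge to the end of a
    base edge, where the hypothesis on roots applies. *)
Lemma induced_end_isolated (e' : edge Y') (b : bool) (v' : vertex Y') (q : G)
    (att : {multiplicative egroup e' -> vgroup v'}) x j :
  N q -> bs_end b (qedge Q e') = bs_vact q (qvert Q v') ->
  (forall c, qvgroup Q v' (att c) = qegroup Q e' c ^ q) ->
  (0 < j)%N -> range att (x ^+ j) -> range att x.
Proof.
move=> Nq endE attE j0 [c _ cE].
have [e [g eE]] := bs_edge_base (qedge Q e').
pose d : dart Y := (e, b).
pose z := (qvgroup Q v' x ^ q^-1) ^ g.
have [Nx xfix] : [set h | N h /\ vact h (qvert Q v') = qvert Q v'] (qvgroup Q v' x).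
  by rewrite -qvgroupP; exists x.
have Nz : N z by do 2!apply: N_conj.
have zfix : bs_vact z (bs_end b (base_edge e)) = bs_end b (base_edge e).
  apply/(conj_fix _ _ _ (@bs_vact1 G S) (@bs_vactM G S)).
  rewrite -bs_end_act -eE endE.
  by apply/(conj_fix _ _ _ (@bs_vact1 G S) (@bs_vactM G S)); rewrite conjgKV.
have [a _ aE] := (fix_end d z).1 zfix.
have zj : z ^+ j = qegroup Q e' c ^ g.
  by rewrite /z -!conjXg -morphX -cE attE conjgK.
have [Nc cfix] : [set h | N h /\ eact h (qedge Q e') = qedge Q e'] (qegroup Q e' c).
  by rewrite -qegroupP; exists c.
have [c1 _ c1E] : eimage S e (z ^+ j).
  apply/fix_base_edge; rewrite zj.
  by apply/(conj_fix _ _ _ (@bs_eact1 G S) (@bs_eactM G S)); rewrite -eE.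
have [c2 _ c2E] : range (iatt d) a.
  apply: (N_roots _ j0); first by rewrite aE; exact: N_conj.
  exists c1 => //; apply: in_vgroup_inj; first exact: tubS.
  apply: (conjg_inj (carrier d)^-1).
  by rewrite carrier_edge in_vgroupX aE -conjXg conjgK c1E.
have zE : z = in_vgroup S (att_src e c2).
  by rewrite -(carrier_edge (d := d)) c2E aE conjgK.
have [c3 _ c3E] : range (qegroup Q e') (qvgroup Q v' x ^ q^-1).
  rewrite qegroupP; split; first exact: N_conj.
  rewrite [eact _ _]/(bs_eact _ _) eE.
  apply/(conj_fix _ _ _ (@bs_eact1 G S) (@bs_eactM G S)); rewrite -/z.
  by apply/fix_base_edge; rewrite zE; exists c2.
exists c3 => //; apply: (@qvgroup_inj _ _ _ _ Q).
by rewrite attE c3E conjgKV.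
Qed.

Lemma induced_primitive : is_primitive Y'.
Proof.
have cyc (e' : edge Y') v' (att : {multiplicative egroup e' -> vgroup v'}) :
    injective att -> (forall x j, (0 < j)%N -> range att (x ^+ j) -> range att x) ->
    is_maximal_cyclic (range att).
  move=> att_inj iso; have Ze := induced_tubular.2 e'.
  apply: isolated_maximal_cyclic => //; first exact: infinite_cyclic_range.
  have [f [f_bij fD]] := Ze; exists (att (f 1%R)); first by exists (f 1%R).
  by rewrite -(morph1 att) => /att_inj; rewrite -(zmod_morph0 fD) => /(bij_inj f_bij).
move=> e'; split; apply: cyc.
- exact: att_src_inj.
- move=> x j; apply: (induced_end_isolated (b := true) (q := qsrc Q e')).
  + exact: qsrc_in.
  + exact: (qsrcP Q).
  + exact: (qatt_src Q).
- exact: att_tgt_inj.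
- move=> x j; apply: (induced_end_isolated (b := false) (q := qtgt Q e')).
  + exact: qtgt_in.
  + exact: (qtgtP Q).
  + exact: (qatt_tgt Q).
Qed.

End QuotientGraph.

(** * The theorem *)

Theorem theorem1p1 (G : groupType) (S : splitting G)
    (tubS : is_tubular (gog S)) :
  residually_finite G <-> virtually_primitive S.
Proof.
split=> [rfG|]; last exact: virtually_primitive_residually_finite.
have [N [sgN N_conj fiN N_roots]] := rooted_subgroup tubS rfG.
have [Y' indY'] := induced_splitting_exists S sgN N_conj fiN.
exists N, Y'; split=> //; case: indY' => Q.
  exact: induced_tubular Q tubS.
exact: induced_primitive Q tubS N_roots.
Qed.
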